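(* Let $p,d$ be integers with $2\le p\le d$, and put $$\alpha_d:=\left(\frac d2\right)^{3/4},\qquad \beta_d:=\frac12\sqrt{\frac{d^2}{4}-1}.$$ Let $\tilde k_{ORF}$ and $\tilde k_{RFF}$ be, respectively, the orthogonal-random-features and the (Gaussian) random-Fourier-features approximate kernels, each built from $p$ random vectors in $\mathbb{R}^d$. Then for all $x,y\in\mathbb{R}^d$ with $z=\|x-y\|\in[0,\max(\alpha_d,\beta_d)]$, $$V[\tilde k_{ORF}(x,y)]\le V[\tilde k_{RFF}(x,y)].$$
   Context: Given vectors $w_1,\dots,w_p\in\mathbb{R}^d$, for $x\in\mathbb{R}^d$ put $$\tilde\phi(x):=\frac1{\sqrt p}\big(\sin(w_1^\top x),\dots,\sin(w_p^\top x),\cos(w_1^\top x),\dots,\cos(w_p^\top x)\big)^\top\in\mathbb{R}^{2p},$$ and $\tilde k(x,y):=\tilde\phi(x)^\top\tilde\phi(y)=\frac1p\sum_{j=1}^p\cos(w_j^\top(x-y))$. The kernel $\tilde k_{ORF}$ is $\tilde k$ when $w_1,\dots,w_p$ are $p$ distinct columns (say the first $p$) of a random $d\times d$ orthogonal matrix distributed according to the Haar probability measure on the orthogonal group $O(d)$. The kernel $\tilde k_{RFF}$ is $\tilde k$ when $w_1,\dots,w_p$ are independent standard Gaussian vectors $\mathcal N(0,\mathrm{Id})$ in $\mathbb{R}^d$ (i.e. columns of a matrix with i.i.d. $\mathcal N(0,1)$ entries). $V$ denotes variance over the randomness of the $w_j$'s, and $\|\cdot\|$ is the Euclidean norm. 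*)

(* Defs.v *)
From HB Require Import structures.
From mathcomp Require Import all_boot all_order all_algebra.
From mathcomp Require Import all_classical all_reals all_analysis.
From mathcomp Require Import ring.

Set Implicit Arguments.
Unset Strict Implicit.
Unset Printing Implicit Defensive.

Import Order.TTheory GRing.Theory Num.Theory.
Import numFieldNormedType.Exports.

Local Open Scope classical_set_scope.
Local Open Scope ring_scope.

Definition dotcv (R : realType) (n : nat) (u v : 'cV[R]_n) : R :=
  (u^T *m v) 0 0.

(* The Euclidean norm; the library norm on matrices is the sup norm. *)
Definition enorm (R : realType) (n : nat) (u : 'cV[R]_n) : R :=
  Num.sqrt (dotcv u u).

Definition feature_map (R : realType) (p d : nat) (w : 'I_p -> 'cV[R]_d)
    (x : 'cV[R]_d) : 'cV[R]_(p + p) :=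
  (Num.sqrt p%:R)^-1 *:
    col_mx (\col_j sin (dotcv (w j) x)) (\col_j cos (dotcv (w j) x)).

Definition approx_kernel (R : realType) (p d : nat) (w : 'I_p -> 'cV[R]_d)
    (x y : 'cV[R]_d) : R :=
  dotcv (feature_map w x) (feature_map w y).

Lemma approx_kernelE (R : realType) (p d : nat) (w : 'I_p -> 'cV[R]_d)
    (x y : 'cV[R]_d) :
  approx_kernel w x y = p%:R^-1 * \sum_(j < p) cos (dotcv (w j) (x - y)).
Proof.
rewrite /approx_kernel /feature_map; set u := col_mx _ _; set v := col_mx _ _.
have -> (a : R) : dotcv (a *: u) (a *: v) = a ^+ 2 * dotcv u v.
  rewrite /dotcv !mxE big_distrr /=; apply: eq_bigr => i _.
  by rewrite !mxE; ring.
rewrite exprVn sqr_sqrtr ?ler0n// /u /v {1}/dotcv tr_col_mx mul_row_col !mxE.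
congr (_ * _); rewrite -big_split /=; apply: eq_bigr => j _.
have -> : dotcv (w j) (x - y) = dotcv (w j) x - dotcv (w j) y.
  by rewrite /dotcv mulmxBr !mxE.
by rewrite !mxE cosB addrC.
Qed.

Definition borelType (T : ptopologicalType) := g_sigma_algebraType (@open T).

Definition orthogonal_group (R : realType) (d : nat) : set 'M[R]_d :=
  [set Q | Q^T *m Q = 1%:M].

(* A Borel probability measure on O(d) is encoded as a Borel probability
   measure on the space of d x d matrices that is concentrated on O(d).
   Left invariance characterizes the Haar probability measure; right
   invariance follows since O(d) is compact. *)
Definition is_haar_orthogonal (R : realType) (d : nat)
    (mu : set (borelType 'M[R]_d) -> \bar R) : Prop :=
  mu (@orthogonal_group R d) = 1%E /\
  forall (Q : 'M[R]_d) (A : set (borelType 'M[R]_d)),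
    orthogonal_group Q -> measurable A -> mu (mulmx Q @` A) = mu A.

Definition mutually_independent (R : realType) (dT : measure_display)
    (T : measurableType dT) (P : probability T R) (I : finType)
    (X : I -> {RV P >-> R}) : Prop :=
  forall (J : {set I}) (B : I -> set R),
    (forall i, measurable (B i)) ->
    P (\bigcap_(i in [set` J]) (X i @^-1` B i)) =
    (\prod_(i in J) P (X i @^-1` B i))%E.

Definition iid_standard_normal (R : realType) (dT : measure_display)
    (T : measurableType dT) (P : probability T R) (I : finType)
    (X : I -> {RV P >-> R}) : Prop :=
  mutually_independent X /\
  forall (i : I) (A : set R),
    measurable A -> distribution P (X i) A = normal_prob 0 1 A.

(* The columns of the random matrix M selected by c. *)
Definition kernel_ORF (R : realType) (dT : measure_display)
    (T : measurableType dT) (P : probability T R) (p d : nat)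
    (M : {RV P >-> borelType 'M[R]_d}) (c : 'I_p -> 'I_d)
    (x y : 'cV[R]_d) : T -> R :=
  fun t => approx_kernel (fun j => col (c j) (M t : 'M[R]_d)) x y.

(* G (i, j) is the i-th coordinate of the j-th random vector. *)
Definition kernel_RFF (R : realType) (dT : measure_display)
    (T : measurableType dT) (P : probability T R) (p d : nat)
    (G : 'I_d * 'I_p -> {RV P >-> R}) (x y : 'cV[R]_d) : T -> R :=
  fun t => approx_kernel (fun j => \col_i G (i, j) t) x y.

Definition alpha (R : realType) (d : nat) : R := (d%:R / 2) `^ (3 / 4).

Definition beta (R : realType) (d : nat) : R :=
  2^-1 * Num.sqrt (d%:R ^+ 2 / 4 - 1).

(* Main.v *)
(* Put n = d/2, s = |x - y|^2, and let F(s) be the power series with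
   F(|u|^2) = E cos(v . u) for v uniform on the unit sphere, so that
   s F'' + n F' + F/4 = 0. If a is a vector of R^p, the sum of the a_j M_(c j) is
   M b with |b| = |a|, so by invariance the ORF variance is
     ((1 + F(4s))/2 + (p - 1) F(2s))/p - F(s)^2,
   and the RFF variance is the same expression with E(s) = exp(-s/2) in place
   of F. Now F is log-concave where it is positive, because W = F'^2 - F F''
   satisfies s W' + (n + 1) W = F'^2; hence F(4s) <= F(2s)^2 <= F(s)^4 as soon as
   F > 0 on [0, 4s], and with S = F(s)^2 the ORF variance is at most
   (1 - S)^2 / (2p), while the RFF variance is (1 - E(s)^2)^2 / (2p). It remains
   to see that F > 0 on [0, 4s] and F(s) >= E(s), which follow by Sturm comparison
   of F with exp(-s/(2n)) on [0, n^2] (this covers beta_d) and with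
   (1 - c s) exp(- k s) on [0, 4 n^(3/2)] (this covers alpha_d). *)
Require Import Defs.
From HB Require Import structures.
From mathcomp Require Import all_boot all_order all_algebra.
From mathcomp Require Import all_classical all_reals all_analysis.
From mathcomp Require Import measurable_realfun ring lra.

Import Order.TTheory GRing.Theory Num.Theory.
Import numFieldNormedType.Exports.

Local Open Scope classical_set_scope.
Local Open Scope ring_scope.

(** * The spherical average of a plane wave *)

(** The uniform law on the sphere is never described by a density. Invariance under reflections
    makes the moments of (M b) . u depend on u only through |u|; comparing them along e_0 + s e_i
    and summing over i gives a recursion for the moments of order 2k, and the cosine series turns
    them into the coefficients of F. The two laws enter the variance only through the mean of cos
    (sum a_j Y_j), a function of |a|^2 s, so one variance formula serves both kernels. For the
    Gaussian, E(2s) = E(s)^2 makes the final bound an equality. All sign statements come from one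
    device: s g' + (c/2) g >= 0 says that z^c g(z^2) is nondecreasing, and it starts at 0. Applied
    to W it yields log-concavity, applied to a Wronskian it yields Sturm comparison. What limits z
    is the positivity of F up to 4s, and neither n^(3/2) nor (n^2 - 1)/4 is the larger for every n,
    hence two comparison functions. The inequality F(s) >= E(s) needs only s <= n^2, which holds in
    both cases. *)

Lemma le_inv_fact_cvg_pseries (R : realType) (c : R^nat) (x : R) :
  (forall k, `|c k| <= k`!%:R^-1) -> cvgn (pseries c x).
Proof.
move=> hc; apply: normed_cvg; rewrite /normed_series_of /=.
apply: (@series_le_cvg _ _ (exp_coeff `|x|)).
- by move=> n.
- by move=> n; rewrite /exp_coeff /=.
- move=> n; rewrite /exp_coeff /= normrM normrX mulrC.
  by apply: ler_wpM2l => //; exact: exprn_ge0.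
- exact: is_cvg_series_exp_coeff.
Qed.

(** The bound 1/k! is chosen because formal differentiation preserves it, (k+1)/(k+1)! being 1/k!.
    One bound on the coefficients thus covers the series and all its derivatives, everywhere. *)
Lemma le_inv_fact_pseries_diffs (R : realType) (c : R^nat) :
  (forall k, `|c k| <= k`!%:R^-1) ->
  forall k, `|pseries_diffs c k| <= k`!%:R^-1.
Proof.
move=> hc k; rewrite /pseries_diffs normrM normr_nat.
apply: (le_trans (ler_wpM2l _ (hc k.+1))) => //.
by rewrite factS natrM invfM mulrA divff ?mul1r// pnatr_eq0.
Qed.

Lemma is_derive_pseries (R : realType) (c : R^nat) (x : R) :
  (forall k, `|c k| <= k`!%:R^-1) ->
  is_derive x 1 (fun t => limn (pseries c t)) (limn (pseries (pseries_diffs c) x)).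
Proof.
move=> hc; apply: (@pseries_snd_diffs _ _ (`|x| + 1)).
- exact: le_inv_fact_cvg_pseries.
- by apply: le_inv_fact_cvg_pseries; exact: le_inv_fact_pseries_diffs.
- apply: le_inv_fact_cvg_pseries; do 2!apply: le_inv_fact_pseries_diffs.
  exact: hc.
- by rewrite [ltRHS]ger0_norm ?addr_ge0// ltrDl.
Qed.

(* Coefficients of the hypergeometric function 0F1(; d/2; -s/4). *)
Definition sphere_coef (R : realType) (d k : nat) : R :=
  (-1) ^+ k * (\prod_(i < k) ((2 * i.+1) * (2 * i + d))%N%:R)^-1.

(* If v is uniform on the unit sphere of R^d then E cos(v . u) is
   sphere_fun d |u|^2. *)
Definition sphere_fun (R : realType) (d : nat) (s : R) : R :=
  limn (pseries (sphere_coef R d) s).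

Definition sphere_fun' (R : realType) (d : nat) (s : R) : R :=
  limn (pseries (pseries_diffs (sphere_coef R d)) s).

Definition sphere_fun'' (R : realType) (d : nat) (s : R) : R :=
  limn (pseries (pseries_diffs (pseries_diffs (sphere_coef R d))) s).

(** This is the differential equation of F read on coefficients: (k+1)(k + d/2) c_(k+1) + c_k/4 = 0,
    multiplied by 4. *)
Lemma sphere_coefS (R : realType) (d k : nat) : (0 < d)%N ->
  sphere_coef R d k =
  - (((2 * k.+1) * (2 * k + d))%N%:R * sphere_coef R d k.+1).
Proof.
move=> d0; rewrite /sphere_coef big_ord_recr /= exprS invfM.
set a := (X in _^-1 * X^-1); set b := (\prod_(i < k) _)^-1.
have a0 : a != 0 by rewrite /a pnatr_eq0 -lt0n muln_gt0/= addn_gt0 d0 orbT.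
rewrite mulN1r mulNr mulrN opprK [b / a]mulrC [RHS]mulrCA.
by rewrite [a * _]mulrA divff// mul1r.
Qed.

Lemma sphere_coef_bound (R : realType) (d k : nat) : (0 < d)%N ->
  `|sphere_coef R d k| <= k`!%:R^-1.
Proof.
move=> d0; rewrite /sphere_coef normrM normrX normrN1 expr1n mul1r.
rewrite normfV lef_pV2 ?posrE ?ltr0n ?fact_gt0//; last first.
  rewrite normr_gt0; apply/prodf_neq0 => i _.
  by rewrite pnatr_eq0 -lt0n muln_gt0/= addn_gt0 d0 orbT.
rewrite -natr_prod normr_nat ler_nat; elim: k => [|k IH].
  by rewrite big_ord0.
rewrite big_ord_recr /= factS mulnC; apply: leq_mul => //.
by rewrite -[leqLHS]muln1; apply: leq_mul; [exact: leq_pmull|rewrite addn_gt0 d0 orbT].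
Qed.

Lemma sphere_fun0 (R : realType) (d : nat) : sphere_fun R d 0 = 1.
Proof.
apply: cvg_lim => //; rewrite -cvg_shiftS /=.
rewrite [X in X @ _ --> _](_ : _ = cst 1); first exact: cvg_cst.
apply/funext => n; rewrite /pseries /series /= big_nat_recl//= big1 ?addr0.
  by rewrite /sphere_coef big_ord0 expr0 mul1r invr1 mul1r.
by move=> i _; rewrite expr0n mulr0.
Qed.

Lemma is_derive_sphere_fun (R : realType) (d : nat) (s : R) : (0 < d)%N ->
  is_derive s 1 (sphere_fun R d) (sphere_fun' R d s).
Proof.
by move=> d0; apply: is_derive_pseries => k; exact: sphere_coef_bound.
Qed.

Lemma is_derive_sphere_fun' (R : realType) (d : nat) (s : R) : (0 < d)%N ->
  is_derive s 1 (sphere_fun' R d) (sphere_fun'' R d s).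
Proof.
move=> d0; apply: is_derive_pseries; apply: le_inv_fact_pseries_diffs => k.
exact: sphere_coef_bound.
Qed.

Lemma derivable_sphere_fun'' (R : realType) (d : nat) (s : R) : (0 < d)%N ->
  derivable (sphere_fun'' R d) s 1.
Proof.
move=> d0; suff h : is_derive s 1 (sphere_fun'' R d)
  (limn (pseries (pseries_diffs (pseries_diffs (pseries_diffs (sphere_coef R d)))) s)).
  exact: ex_derive.
apply: is_derive_pseries; do 2!apply: le_inv_fact_pseries_diffs.
by move=> k; exact: sphere_coef_bound.
Qed.

Lemma sphere_fun_ode (R : realType) (d : nat) (s : R) : (0 < d)%N ->
  s * sphere_fun'' R d s + d%:R / 2 * sphere_fun' R d s
  + sphere_fun R d s / 4 = 0.
Proof.
move=> d0.
have B0 k := sphere_coef_bound R d k d0.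
have B1 := le_inv_fact_pseries_diffs R _ B0.
have B2 := le_inv_fact_pseries_diffs R _ B1.
have C0 := le_inv_fact_cvg_pseries R _ s B0.
have C1 := le_inv_fact_cvg_pseries R _ s B1.
(* This form of the series of F'' has terms of degree [i.-1], so that multiplication by s restores
   degree i. The partial sums of the left-hand side then vanish term by term; at i = 0 the factor i
   takes care of the truncated predecessor. *)
have C2 := pseries_diffs_equiv (le_inv_fact_cvg_pseries R _ s B2).
have C := cvgD (cvgD (cvgM (cvg_cst s) C2) (cvgM (cvg_cst (d%:R / 2 : R)) C1))
  (cvgM C0 (cvg_cst (4^-1 : R))).
have FF : Filter (nbhs \oo) by exact: _.
have {}C := C FF FF FF FF FF FF FF FF.
rewrite -[LHS](cvg_lim (@Rhausdorff R) C).
apply: cvg_lim => //.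
rewrite [X in X @ _ --> _](_ : _ = cst 0); first exact: cvg_cst.
apply/funext => n; rewrite !fctE /pseries /series /=.
rewrite !mulr_sumr mulr_suml -!big_split /=; apply: big1 => i _.
have -> : s * (i%:R * pseries_diffs (sphere_coef R d) i * s ^+ i.-1) =
  i%:R * pseries_diffs (sphere_coef R d) i * s ^+ i.
  by case: i => [|i]; rewrite ?mul0r ?mulr0//= exprS mulrCA.
rewrite [sphere_coef R d i](sphere_coefS _ _ _ d0) /pseries_diffs.
by rewrite !natrM natrD natrM -natr1; field.
Qed.

(** * Monotonicity, signs and first zeros *)

Lemma ger0_is_derive_le (R : realType) (f df : R -> R) (a b : R) : a <= b ->
  (forall x : R, a <= x <= b -> is_derive x 1 f (df x)) ->
  (forall x : R, a <= x <= b -> 0 <= df x) -> f a <= f b.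
Proof.
move=> ab fdf df0; rewrite -subr_ge0.
have [] := @MVT_segment R f df a b ab.
- by move=> x; rewrite in_itv/= => /andP[ax xb]; apply: fdf; rewrite !ltW.
- apply: derivable_within_continuous => x; rewrite in_itv/= => xab.
  exact: (@ex_derive _ _ _ _ _ _ _ (fdf x xab)).
- move=> x; rewrite in_itv/= => xab ->.
  by rewrite mulr_ge0 ?df0// subr_ge0.
Qed.

(* With s = z^2, the hypothesis says that z^c g(z^2) is nondecreasing. *)
Lemma radial_ge0 (R : realType) (c : nat) (g g' : R -> R) (T : R) : (0 < c)%N ->
  (forall s : R, 0 <= s <= T -> is_derive s 1 g (g' s)) ->
  (forall s : R, 0 <= s <= T -> 0 <= s * g' s + c%:R / 2 * g s) ->
  forall s : R, 0 <= s <= T -> 0 <= g s.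
Proof.
move=> c0 gg' h s /andP[s0 sT].
have c2 : 0 < c%:R / 2 :> R by rewrite divr_gt0 ?ltr0n.
have [->|sn0] := eqVneq s 0.
  have := h 0; rewrite lexx (le_trans s0 sT) => /(_ isT).
  by rewrite mul0r add0r pmulr_rge0.
(* In the variable z the integrating factor s^(c/2) is an integer power, even for odd c. *)
pose Phi (z : R) := z ^+ c * g (z ^+ 2).
pose dPhi (z : R) := z ^+ c * (g' (z ^+ 2) * (2 * z)) + g (z ^+ 2) * (c%:R * z ^+ c.-1).
have sq (x : R) : 0 <= x <= Num.sqrt s -> 0 <= x ^+ 2 <= T.
  move=> /andP[x0 xs]; rewrite sqr_ge0 (le_trans _ sT)//.
  by rewrite -(sqr_sqrtr s0) lerXn2r ?nnegrE ?sqrtr_ge0.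
have dP (x : R) : 0 <= x <= Num.sqrt s -> is_derive x 1 Phi (dPhi x).
  move=> /sq xT.
  have D2 := gg' _ xT.
  have D1 : is_derive x (1 : R) (fun z : R => z ^+ 2) (2 * x).
    by apply: is_derive_eq; rewrite /= /GRing.scale /=; ring.
  have D3 := @is_derive1_comp _ g (fun z : R => z ^+ 2) x _ _ D2 D1.
  have D4 : is_derive x (1 : R) (fun z : R => z ^+ c) (c%:R * x ^+ c.-1).
    rewrite [X in is_derive _ _ X](_ : _ = (id : R -> R) ^+ c); last first.
      by apply/funext => z; rewrite exprfctE.
    apply: (is_derive_eq (is_deriveX c (is_derive_id x (1 : R)))).
    by rewrite /= /GRing.scale /=; ring.
  exact: (is_deriveM D4 D3).
have : Phi 0 <= Phi (Num.sqrt s).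
  apply: (ger0_is_derive_le _ _ dPhi _ _ _ dP); first exact: sqrtr_ge0.
  move=> x /[dup] /sq xT /andP[x0 _].
  have -> : dPhi x = 2 * x ^+ c.-1 * (x ^+ 2 * g' (x ^+ 2) + c%:R / 2 * g (x ^+ 2)).
    by rewrite /dPhi -{1}(prednK c0) exprS; field.
  by rewrite mulr_ge0 ?h// mulr_ge0// exprn_ge0.
rewrite /Phi expr0n eqn0Ngt c0 mul0r sqr_sqrtr// pmulr_rge0// exprn_gt0//.
by rewrite sqrtr_gt0 lt_neqAle eq_sym sn0.
Qed.

(** The point is the infimum of the set where f <= 0. Were f positive there, it would be positive on
    a ball around it, yet that ball contains points of the set. *)
Lemma first_nonpos (R : realType) (f : R -> R) (T : R) :
  {within `[0, T], continuous f} -> 0 < f 0 ->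
  (exists2 t, 0 <= t <= T & f t <= 0) ->
  exists t, [/\ 0 <= t <= T, f t <= 0 & forall r : R, 0 <= r < t -> 0 < f r].
Proof.
move=> cf f0 [t /andP[t0 tT] ft].
pose A := [set r | 0 <= r <= t /\ f r <= 0].
have At : A t by split=> //; rewrite t0 lexx.
have infA : has_inf A.
  by split; [exists t|exists 0 => r [/andP[]]].
pose i := inf A.
have i0 : 0 <= i by apply: lb_le_inf; [exists t|move=> r [/andP[]]].
have it : i <= t by apply: ge_inf => //; case: infA.
have fr r : 0 <= r < i -> 0 < f r.
  move=> /andP[r0 ri]; rewrite ltNge; apply/negP => fr.
  suff : i <= r by rewrite leNgt ri.
  apply: ge_inf; first by case: infA.
  by split=> //; rewrite r0 (le_trans (ltW ri)).
exists i; split => //; first by rewrite i0 (le_trans it).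
rewrite leNgt; apply/negP => fi.
have ciT : `[0, T]%classic i by rewrite /= in_itv/= i0 (le_trans it).
have /subspace_continuousP/(_ _ ciT)/cvgrPdist_lt/(_ _ fi) := cf.
rewrite /within/= => /nbhs_ballP[e /= e0 he].
have [r [/andP[r0 rt] fr0] rie] := inf_adherent e0 infA.
have : i <= r by apply: ge_inf; [case: infA|split; rewrite ?r0].
move=> ir; have : ball i e r.
  by rewrite /ball/= distrC ger0_norm ?subr_ge0// ltrBlDl.
move=> /he; rewrite in_itv/= r0 (le_trans rt tT) => /(_ isT).
rewrite ltr_norml => /andP[_]; rewrite ltrBlDl ltrDr => fr1.
by have := lt_le_trans fr1 fr0; rewrite ltxx.
Qed.

(** * Log-concavity and Sturm comparison for F *)

Section sphere_fun_bounds.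
Variables (R : realType) (d : nat).
Hypothesis d0 : (0 < d)%N.
Local Notation F := (sphere_fun R d).
Local Notation F' := (sphere_fun' R d).
Local Notation F'' := (sphere_fun'' R d).
Local Notation n := (d%:R / 2 : R).

Let n0 : 0 < n. Proof. by rewrite divr_gt0 ?ltr0n. Qed.

(* W = F'^2 - F F'' satisfies s W' + (n + 1) W = F'^2 by the equation of F. *)
Lemma sphere_fun_laguerre (s : R) : 0 <= s -> F s * F'' s <= F' s ^+ 2.
Proof.
move=> s0; rewrite -subr_ge0.
pose F3 (t : R) : R := 'D_(1 : R) F'' t.
pose W (t : R) : R := F' t ^+ 2 - F t * F'' t.
pose W' (t : R) : R := F' t * F'' t - F t * F3 t.
have D3 (t : R) : is_derive t (1 : R) F'' (F3 t).
  by split=> //; exact: derivable_sphere_fun''.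
have dW (t : R) : is_derive t (1 : R) W (W' t).
  have D1 := is_derive_sphere_fun R d t d0.
  have D2 := is_derive_sphere_fun' R d t d0.
  have D4 := D3 t.
  apply: is_derive_eq; rewrite /= /GRing.scale /= /W'; ring.
have ode' (t : R) : t * F3 t + (n + 1) * F'' t + F' t / 4 = 0.
  have D1 := is_derive_sphere_fun R d t d0.
  have D2 := is_derive_sphere_fun' R d t d0.
  have D4 := D3 t.
  have H : is_derive t (1 : R) (fun t : R => t * F'' t + n * F' t + F t * 4^-1)
      (t * F3 t + (n + 1) * F'' t + F' t / 4).
    apply: is_derive_eq; rewrite /= /GRing.scale /=; ring.
  move: H; rewrite (_ : (fun t : R => _) = cst 0) => [H|]; last first.
    by apply/funext => x; exact: sphere_fun_ode.
  by rewrite -[LHS](@derive_val _ _ _ _ _ _ _ H) derive_cst.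
(* The exponent d + 2 is the one for which (d + 2)/2 = n + 1. *)
have := @radial_ge0 R d.+2 W W' s isT (fun t _ => dW t).
apply; last by rewrite s0 lexx.
move=> t /andP[t0 ts]; suff -> : t * W' t + d.+2%:R / 2 * W t = F' t ^+ 2.
  exact: sqr_ge0.
have E1 := sphere_fun_ode R d t d0.
have E2 := ode' t.
rewrite /W' /W -addn2 natrD mulrDl divff//.
apply/eqP; rewrite -subr_eq0; apply/eqP.
(* F' times the equation minus F times its derivative: the terms F F'/4 cancel. *)
have -> : t * (F' t * F'' t - F t * F3 t) +
    (n + 1) * (F' t ^+ 2 - F t * F'' t) - F' t ^+ 2 =
  F' t * (t * F'' t + n * F' t + F t / 4) -
  F t * (t * F3 t + (n + 1) * F'' t + F' t / 4) by field.
by rewrite E1 E2 !mulr0 subrr.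
Qed.

Let derF (t : R) : is_derive t (1 : R) F (F' t) := is_derive_sphere_fun R d t d0.
Let derF' (t : R) : is_derive t (1 : R) F' (F'' t) := is_derive_sphere_fun' R d t d0.

(* F is log-concave and F 0 = 1. *)
Lemma sphere_fun_double (s : R) : 0 <= s ->
  (forall t : R, 0 <= t <= 2 * s -> 0 < F t) -> F (2 * s) <= F s ^+ 2.
Proof.
move=> s0 Fpos.
have F_neq0 t : 0 <= t <= 2 * s -> F t != 0 by move=> /Fpos /lt0r_neq0.
have logder a b : 0 <= a -> a <= b -> b <= 2 * s -> F' b / F b <= F' a / F a.
  move=> a0 ab bs; rewrite -lerN2.
  have tS t : a <= t <= b -> 0 <= t <= 2 * s.
    by move=> /andP[at_ tb]; rewrite (le_trans a0)// (le_trans tb).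
  apply: (ger0_is_derive_le _ (fun t => - (F' t / F t))
    (fun t => (F' t ^+ 2 - F t * F'' t) / F t ^+ 2) a b ab).
    move=> t /tS /F_neq0 Ft.
    have D1 := is_deriveV Ft (derF t).
    have D2 := is_deriveN (is_deriveM (derF' t) D1).
    by apply: (is_derive_eq D2); rewrite /= /GRing.scale /=; field.
  move=> t /tS /andP[t0 _]; rewrite divr_ge0 ?sqr_ge0// subr_ge0.
  exact: sphere_fun_laguerre.
(* A quotient in place of logarithms: the logarithmic derivative of D is 2 (F'/F at t - F'/F at 2t),
   nonnegative because F'/F is nonincreasing. *)
pose D t := F t ^+ 2 / F (2 * t).
have : D 0 <= D s.
  apply: (ger0_is_derive_le _ D
    (fun t => 2 * D t * (F' t / F t - F' (2 * t) / F (2 * t))) 0 s s0).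
    move=> t /andP[t0 ts].
    have Ft : F t != 0 by apply: F_neq0; lra.
    have F2t : F (2 * t) != 0 by apply: F_neq0; lra.
    have D1 : is_derive t (1 : R) (fun t : R => 2 * t) 2.
      by apply: is_derive_eq; rewrite /= /GRing.scale /=; ring.
    have D2 := is_derive1_comp (derF (2 * t)) D1.
    have D3 := @is_deriveV R (F \o (fun t => 2 * t)) _ _ _ F2t D2.
    have D4 := is_deriveM (is_deriveX 2 (derF t)) D3.
    by apply: (is_derive_eq D4); rewrite /= /GRing.scale /= /D exprfctE; field; rewrite Ft F2t.
  move=> t /andP[t0 ts]; apply: mulr_ge0; last first.
    by rewrite subr_ge0; apply: logder => //; lra.
  rewrite mulr_ge0// /D divr_ge0 ?sqr_ge0// ltW// Fpos//; lra.
rewrite /D mulr0 sphere_fun0 expr1n divr1.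
by rewrite ler_pdivlMr ?mul1r// Fpos//; lra.
Qed.

(* The Wronskian N = F' G - F G' satisfies s N' + n N >= 0 as long as F >= 0, and
   N >= 0 means that F / G is nondecreasing. *)
Lemma sphere_fun_comparison (G G' G'' : R -> R) (T : R) : G 0 = 1 ->
  (forall t : R, 0 <= t <= T -> is_derive t 1 G (G' t)) ->
  (forall t : R, 0 <= t <= T -> is_derive t 1 G' (G'' t)) ->
  (forall t : R, 0 <= t <= T -> 0 < G t) ->
  (forall t : R, 0 <= t <= T -> t * G'' t + n * G' t + G t / 4 <= 0) ->
  forall t : R, 0 <= t <= T -> G t <= F t.
Proof.
move=> G0 dG dG' Gpos hG.
(* The Wronskian argument needs F >= 0, which is part of what has to be shown. This conditional form
   is later applied up to the first zero of F. *)
have key S : 0 <= S <= T -> (forall t : R, 0 <= t <= S -> 0 <= F t) -> G S <= F S.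
  move=> /andP[S0 ST] FS.
  have tT t : 0 <= t <= S -> 0 <= t <= T.
    by move=> /andP[-> /= tS]; exact: le_trans ST.
  pose N t := F' t * G t - F t * G' t.
  pose N' t := F'' t * G t - F t * G'' t.
  have Npos t : 0 <= t <= S -> 0 <= N t.
    apply: (radial_ge0 _ d N N' S d0) => {}t tS.
      have D1 := derF t; have D2 := derF' t.
      have D3 := dG _ (tT _ tS); have D4 := dG' _ (tT _ tS).
      by apply: is_derive_eq; rewrite /= /GRing.scale /= /N'; ring.
    have -> : t * N' t + n * N t =
      G t * (t * F'' t + n * F' t + F t / 4) -
      F t * (t * G'' t + n * G' t + G t / 4) by rewrite /N /N'; field.
    rewrite sphere_fun_ode// mulr0 sub0r oppr_ge0.
    by apply: mulr_ge0_le0; [exact: FS|apply: hG; exact: tT].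
  have : F 0 / G 0 <= F S / G S.
    apply: (ger0_is_derive_le _ (fun t => F t / G t)
      (fun t => N t / G t ^+ 2) 0 S S0) => t tS.
      have Gt : G t != 0 by rewrite gt_eqF// Gpos// tT.
      have D1 := is_deriveM (derF t) (is_deriveV Gt (dG _ (tT _ tS))).
      by apply: (is_derive_eq D1); rewrite /= /GRing.scale /= /N; field.
    by rewrite divr_ge0 ?sqr_ge0// Npos.
  rewrite G0 sphere_fun0 divr1 ler_pdivlMr ?mul1r// Gpos//.
  by rewrite S0 ST.
have cF : {within `[0, T], continuous F}.
  apply: derivable_within_continuous => x _.
  exact: (@ex_derive _ _ _ _ _ _ _ (derF x)).
(* At the first point r where F <= 0, [key] would give F r >= G r > 0. *)
suff FT t : 0 <= t <= T -> 0 < F t.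
  move=> t /andP[t0 tT]; apply: key; first by rewrite t0.
  by move=> r /andP[r0 rt]; rewrite ltW// FT// r0 (le_trans rt).
move=> tT; rewrite ltNge; apply/negP => Ft.
have F0 : 0 < F 0 by rewrite sphere_fun0.
have [r [/andP[r0 rT] Fr Fpos]] := first_nonpos _ _ _ cF F0 (ex_intro2 _ _ t tT Ft).
have rn0 : 0 < r.
  rewrite lt_neqAle r0 andbT; apply/eqP => r0'.
  by move: Fr; rewrite -r0' leNgt F0.
suff : 0 < F r by rewrite ltNge Fr.
apply: lt_le_trans (key r _ _); first by rewrite Gpos// r0.
  by rewrite r0.
(* [key] asks for F >= 0 at r as well. If F r < 0, continuity makes F negative at v, a point of [0,
   r) closer to r than e, where F is known to be positive. *)
have c0 : {for r, continuous F}.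
  apply: differentiable_continuous; apply/derivable1_diffP.
  exact: (@ex_derive _ _ _ _ _ _ _ (derF r)).
move=> u /andP[u0]; rewrite le_eqVlt => /predU1P[->|ur]; last by rewrite ltW// Fpos// u0.
rewrite leNgt; apply/negP => Fr0.
have := c0 => /cvgrPdist_lt /(_ (- F r)); rewrite oppr_gt0 => /(_ Fr0).
move=> /nbhs_ballP[e /= e0 he].
pose v := Num.max (r / 2) (r - e / 2).
have vr : v < r by rewrite /v gt_max; apply/andP; split; lra.
have v0 : 0 <= v by rewrite /v le_max; apply/orP; left; lra.
have /he : ball r e v.
  rewrite /ball/= ger0_norm ?subr_ge0 ?(ltW vr)//.
  have : r - e / 2 <= v by rewrite /v le_max lexx orbT.
  by lra.
rewrite ltr_norml => /andP[h _]; have : 0 < F v by rewrite Fpos// v0.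
by lra.
Qed.

(** The second hypothesis is the differential inequality of [sphere_fun_comparison] for G t = (1 - c
    t) exp(- k t), with the exponential divided out. *)
Lemma sphere_fun_comparison_exp (c k T : R) :
  (forall t : R, 0 <= t <= T -> 0 < 1 - c * t) ->
  (forall t : R, 0 <= t <= T -> t * (2 * c * k + k ^+ 2 * (1 - c * t))
    - n * (c + k * (1 - c * t)) + (1 - c * t) / 4 <= 0) ->
  forall t : R, 0 <= t <= T -> (1 - c * t) * expR (- (k * t)) <= F t.
Proof.
move=> pos hG.
pose e (t : R) := expR (- (k * t)).
have de (t : R) : is_derive t 1 e (- (k * e t)).
  have D : is_derive t (1 : R) (fun t : R => - (k * t)) (- k).
    by apply: is_derive_eq; rewrite /= /GRing.scale /=; ring.
  by apply: (is_derive_eq (is_derive1_comp (is_derive_expR _) D)); rewrite /e; ring.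
apply: (sphere_fun_comparison (fun t => (1 - c * t) * e t)
  (fun t => - (c + k * (1 - c * t)) * e t)
  (fun t => (2 * c * k + k ^+ 2 * (1 - c * t)) * e t) T) => //.
- by rewrite /e !mulr0 subr0 oppr0 expR0 mul1r.
- by move=> t _; apply: is_derive_eq; rewrite /= /GRing.scale /=; ring.
- by move=> t _; apply: is_derive_eq; rewrite /= /GRing.scale /=; ring.
- by move=> t tT; rewrite mulr_gt0 ?expR_gt0// pos.
- move=> t tT.
  have -> : t * ((2 * c * k + k ^+ 2 * (1 - c * t)) * e t) +
     n * (- (c + k * (1 - c * t)) * e t) + (1 - c * t) * e t / 4 =
   (t * (2 * c * k + k ^+ 2 * (1 - c * t))
    - n * (c + k * (1 - c * t)) + (1 - c * t) / 4) * e t by field.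
  by rewrite mulr_le0_ge0 ?expR_ge0// hG.
Qed.

(** For c = 0 the condition is t k^2 - n k + 1/4 <= 0, that is t <= n/k - 1/(4 k^2). The rate k =
    1/(2n) = 1/d maximizes this bound, whose value is then n^2. *)
Lemma sphere_fun_ge_exp (s : R) : 0 <= s <= n ^+ 2 -> expR (- (s / d%:R)) <= F s.
Proof.
have dR : 0 < d%:R :> R by rewrite ltr0n.
move=> sn.
have := sphere_fun_comparison_exp 0 d%:R^-1 (n ^+ 2).
move=> /(_ _ _ _ sn); rewrite mul0r subr0 mul1r [_^-1 * _]mulrC; apply.
  by move=> t _; rewrite mul0r subr0.
move=> t /andP[t0 tT]; rewrite !mul0r subr0 !mulr1 mulr0 mul0r !add0r.
have -> : t * d%:R^-1 ^+ 2 - n * d%:R^-1 + 1 / 4 =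
  (t - n ^+ 2) * d%:R^-1 ^+ 2 by field; rewrite gt_eqF.
by rewrite mulr_le0_ge0 ?sqr_ge0// subr_le0.
Qed.

(* The constants make (1 - c s) exp(- k s) agree with F to second order at 0. *)
Lemma sphere_fun_gt0 (s : R) : 0 <= s <= 4 * n * Num.sqrt n -> 0 < F s.
Proof.
move=> sn; pose r := Num.sqrt (n + 1).
have r2 : r ^+ 2 = n + 1 by rewrite sqr_sqrtr// addr_ge0// ltW.
have r0 : 0 < r by rewrite sqrtr_gt0 addr_gt0.
have nr : Num.sqrt n < r by rewrite ltr_sqrt ?addr_gt0// ltrDl.
(* The first order condition is c + k = r c = 1/(4n) = - F'(0). The zero 1/c = 4 n sqrt(n + 1) of
   the linear factor lies just beyond the interval. *)
pose c := (4 * n * r)^-1; pose k := (r - 1) * c.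
have nr0 : 0 < 4 * n * r by rewrite mulr_gt0// mulr_gt0.
have pos t : 0 <= t <= 4 * n * Num.sqrt n -> 0 < 1 - c * t.
  move=> /andP[t0 tT]; rewrite subr_gt0 /c mulrC ltr_pdivrMr// mul1r.
  by apply: (le_lt_trans tT); rewrite ltr_pM2l// mulr_gt0.
suff hG t : 0 <= t <= 4 * n * Num.sqrt n ->
    t * (2 * c * k + k ^+ 2 * (1 - c * t))
    - n * (c + k * (1 - c * t)) + (1 - c * t) / 4 <= 0.
  apply: (lt_le_trans _ (sphere_fun_comparison_exp c k _ pos hG _ sn)).
  by rewrite mulr_gt0 ?expR_gt0 ?pos.
move=> /andP[t0 tT].
(* Grouped by powers of t, the constant and the linear coefficients vanish by the choice of c, k and
   r, and - k^2 c t^2 remains. *)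
have -> : t * (2 * c * k + k ^+ 2 * (1 - c * t))
    - n * (c + k * (1 - c * t)) + (1 - c * t) / 4 =
  - (k ^+ 2 * c * t ^+ 2) + (c * n * (4^-1 / n * c^-1 - r)
    + t * c ^+ 2 * (r ^+ 2 - 1 + n * (r - 1) - 4^-1 / c)).
  rewrite /k; field; rewrite gt_eqF//=; last by rewrite invr_gt0.
  by move: n0 => /gt_eqF; rewrite mulf_eq0 => /negbT; rewrite negb_or => /andP[].
have -> : 4^-1 / n * c^-1 - r = 0.
  rewrite /c invrK; field.
  by move: n0 => /gt_eqF; rewrite mulf_eq0 => /negbT; rewrite negb_or => /andP[].
have -> : r ^+ 2 - 1 + n * (r - 1) - 4^-1 / c = 0 by rewrite /c invrK r2; field.
rewrite !mulr0 !addr0 oppr_le0 mulr_ge0 ?sqr_ge0// mulr_ge0 ?sqr_ge0//.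
by rewrite invr_ge0 ltW.
Qed.

End sphere_fun_bounds.

(** * Laws and integrals *)

Lemma integrable_bounded_mul (d : measure_display) (T : measurableType d)
    (R : realType) (mu : {measure set T -> \bar R}) (D : set T)
    (h w : T -> R) (C : R) :
  measurable D -> measurable_fun D h -> (forall x, D x -> `|h x| <= C) ->
  mu.-integrable D (EFin \o w) ->
  mu.-integrable D (EFin \o (fun x => h x * w x)).
Proof.
move=> mD mh hC iw.
have bh : [bounded h x | x in D].
  exists C; split; first exact: num_real.
  by move=> M CM x Dx /=; rewrite (le_trans (hC x Dx))// ltW.
by have := integrableMr mD mh bh iw.
Qed.

Lemma integrable_scale (d : measure_display) (T : measurableType d)
    (R : realType) (mu : {measure set T -> \bar R}) (D : set T)
    (w : T -> R) (C : R) :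
  measurable D -> mu.-integrable D (EFin \o w) ->
  mu.-integrable D (EFin \o (fun x => C * w x)).
Proof. by move=> mD iw; exact: (integrableZl mD C iw). Qed.

Lemma integrable_sum_EFin (d : measure_display) (T : measurableType d)
    (R : realType) (mu : {measure set T -> \bar R}) (D : set T)
    (I : Type) (r : seq I) (P : pred I) (f : I -> T -> R) :
  measurable D -> (forall i, P i -> mu.-integrable D (EFin \o f i)) ->
  mu.-integrable D (EFin \o (fun x => \sum_(i <- r | P i) f i x)).
Proof.
move=> mD hf; rewrite [X in _.-integrable _ X](_ : _ =
  fun x => (\sum_(i <- r | P i) (EFin \o f i) x)%E); first exact: integrable_sum.
by apply/funext => x /=; rewrite sumEFin.
Qed.

Lemma Rintegral_sum (d : measure_display) (T : measurableType d)
    (R : realType) (mu : {measure set T -> \bar R}) (D : set T)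
    (I : Type) (r : seq I) (P : pred I) (f : I -> T -> R) :
  measurable D -> (forall i, P i -> mu.-integrable D (EFin \o f i)) ->
  \int[mu]_(x in D) (\sum_(i <- r | P i) f i x) =
  \sum_(i <- r | P i) \int[mu]_(x in D) f i x.
Proof.
move=> mD hf; elim: r => [|i r IH].
  rewrite big_nil; under eq_Rintegral do rewrite big_nil.
  by rewrite Rintegral_cst// mul0r.
rewrite big_cons -IH; case: ifPn => Pi.
  under eq_Rintegral do rewrite big_cons Pi.
  by rewrite RintegralD//; [exact: hf|exact: integrable_sum_EFin].
by under eq_Rintegral do rewrite big_cons (negbTE Pi).
Qed.

(** The sum counts the positive integers up to y, so it is the integer part of y; y <= K guarantees
    that none is missed. *)
Lemma sum_le_truncn (R : realType) (K : nat) (y : R) : 0 <= y <= K%:R ->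
  `|y - \sum_(k < K) (k.+1%:R <= y)%R%:R| <= 1.
Proof.
move=> /andP[y0 yK].
have -> : \sum_(k < K) ((k.+1%:R <= y)%R%:R : R) = (Num.truncn y)%:R.
  rewrite -natr_sum; congr _%:R.
  under eq_bigr do rewrite -truncn_gt_nat.
  have mK : (Num.truncn y <= K)%N.
    by rewrite -(ler_nat R) (le_trans _ yK)// truncn_le.
  rewrite -(big_mkord xpredT (fun k => (k < Num.truncn y)%N : nat)).
  rewrite (@big_cat_nat _ _ _ (Num.truncn y))//= -[RHS]addn0; congr addn.
    rewrite big_nat (eq_bigr (fun=> 1%N)); last by move=> i /andP[_ ->].
    by rewrite -big_nat sum_nat_const_nat subn0 muln1.
  rewrite big_nat big1// => i /andP[ki _]; by rewrite ltnNge ki.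
have /andP[h1 h2] := truncn_itv y0.
rewrite ger0_norm ?subr_ge0// lerBlDl.
by move: h2; rewrite -natr1 => /ltW.
Qed.

(* f is a uniform limit of combinations of indicators of its superlevel sets. *)
Lemma eq_weighted_law (R : realType) (d1 d2 : measure_display)
    (T1 : measurableType d1) (T2 : measurableType d2)
    (m1 : {measure set T1 -> \bar R}) (m2 : {measure set T2 -> \bar R})
    (X1 w1 : T1 -> R) (X2 w2 : T2 -> R) (f : R -> R) (C : R) :
  measurable_fun setT X1 -> measurable_fun setT X2 ->
  m1.-integrable setT (EFin \o w1) -> m2.-integrable setT (EFin \o w2) ->
  (forall B, measurable B -> \int[m1]_x (\1_B (X1 x) * w1 x) =
                             \int[m2]_x (\1_B (X2 x) * w2 x)) ->
  measurable_fun setT f -> (forall x, `|f x| <= C) ->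
  \int[m1]_x (f (X1 x) * w1 x) = \int[m2]_x (f (X2 x) * w2 x).
Proof.
move=> mX1 mX2 iw1 iw2 hB.
have pos (g : R -> R) (K : nat) : measurable_fun setT g -> (forall x, 0 <= g x <= K%:R) ->
    \int[m1]_x (g (X1 x) * w1 x) = \int[m2]_x (g (X2 x) * w2 x).
  move=> mg gK.
  (* Summing the indicators of these sets over k gives the integer part of N g, so [gN] is within
     1/N of g. The number K N of levels is finite because g <= K. *)
  pose B (N k : nat) : set R := [set y | k.+1%:R <= N%:R * g y].
  have mB N k : measurable (B N k).
    have -> : B N k = (fun y => N%:R * g y) @^-1` `[k.+1%:R, +oo[.
      by apply/seteqP; split => y; rewrite /B/= in_itv/= andbT.
    rewrite -[X in measurable X]setTI.
    have mNg : measurable_fun setT (fun y => N%:R * g y) by exact: measurable_funM.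
    by apply: mNg => //; exact: measurable_itv.
  pose gN (N : nat) (y : R) : R := N%:R^-1 * \sum_(k < K * N) \1_(B N k) y.
  have approx N y : (0 < N)%N -> `|g y - gN N y| <= N%:R^-1.
    move=> N0; have NR : 0 < N%:R :> R by rewrite ltr0n.
    have -> : g y - gN N y = N%:R^-1 * (N%:R * g y - \sum_(k < K * N) \1_(B N k) y).
      by rewrite /gN; field; rewrite gt_eqF.
    rewrite normrM gtr0_norm ?invr_gt0// -[leRHS]mulr1 ler_pM2l ?invr_gt0//.
    under eq_bigr do rewrite indicE mem_setE.
    apply: sum_le_truncn; have /andP[g0 gKy] := gK y.
    by rewrite mulr_ge0//= natrM mulrC ler_pM2r.
  have bnd (d : measure_display) (T : measurableType d)
      (m : {measure set T -> \bar R}) (X w : T -> R) N :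
      measurable_fun setT X -> m.-integrable setT (EFin \o w) -> (0 < N)%N ->
    `|\int[m]_x (g (X x) * w x) - \int[m]_x (gN N (X x) * w x)| <=
      N%:R^-1 * \int[m]_x `|w x|.
    move=> mX iw N0.
    have mgN : measurable_fun setT (gN N \o X).
      apply: measurable_funM => //; apply: measurable_sum => k.
      by apply: measurableT_comp => //; exact: measurable_indic.
    have mgX : measurable_fun setT (g \o X) by exact: measurableT_comp.
    have ig : m.-integrable setT (EFin \o (fun x => g (X x) * w x)).
      apply: (@integrable_bounded_mul _ _ _ _ _ (g \o X) w K%:R) => //.
      by move=> x _ /=; have /andP[g0 gKx] := gK (X x); rewrite ger0_norm.
    have igN : m.-integrable setT (EFin \o (fun x => gN N (X x) * w x)).
      apply: (@integrable_bounded_mul _ _ _ _ _ (gN N \o X) w (K%:R + N%:R^-1)) => //.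
      move=> x _ /=; have /andP[g0 gKx] := gK (X x).
      have := approx N (X x) N0; rewrite ler_norml => /andP[h1 h2].
      have N1 : 0 <= N%:R^-1 :> R by rewrite invr_ge0.
      by rewrite ler_norml; apply/andP; split; lra.
    rewrite -RintegralB//.
    have iB : m.-integrable setT
        (EFin \o (fun x => (g (X x) - gN N (X x)) * w x)).
      apply: (@integrable_bounded_mul _ _ _ _ _ (fun x => g (X x) - gN N (X x)) w N%:R^-1) => //.
        exact: measurable_funB.
      by move=> x _; exact: approx.
    under eq_Rintegral do rewrite -mulrBl.
    apply: (le_trans (le_normr_Rintegral _ iB)) => //.
    rewrite -RintegralZl//; last exact: integrable_norm.
    apply: le_Rintegral => //.
    - exact: integrable_norm.
    - by apply: integrable_scale => //; exact: integrable_norm.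
    - by move=> x _; rewrite normrM ler_wpM2r// approx.
  have eqN N : \int[m1]_x (gN N (X1 x) * w1 x) = \int[m2]_x (gN N (X2 x) * w2 x).
    have expand (d : measure_display) (T : measurableType d)
        (m : {measure set T -> \bar R}) (X w : T -> R) :
        measurable_fun setT X -> m.-integrable setT (EFin \o w) ->
      \int[m]_x (gN N (X x) * w x) =
      N%:R^-1 * \sum_(k < K * N) \int[m]_x (\1_(B N k) (X x) * w x).
      move=> mX iw.
      have iB k : m.-integrable setT (EFin \o (fun x => \1_(B N k) (X x) * w x)).
        apply: (@integrable_bounded_mul _ _ _ _ _ (\1_(B N k) \o X) w 1) => //.
          by apply: measurableT_comp => //; exact: measurable_indic.
        by move=> x _ /=; rewrite indicE normr_nat lern1 leq_b1.
      rewrite -Rintegral_sum// -RintegralZl//; last exact: integrable_sum_EFin.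
      by apply: eq_Rintegral => x _; rewrite /gN -mulrA mulr_suml.
    by rewrite !expand//; congr (_ * _); apply: eq_bigr => k _; exact: hB.
  apply/eqP; rewrite -subr_eq0 -normr_le0; apply/ler_addgt0Pl => e e0.
  rewrite addr0.
  set A := (\int[m1]_x `|w1 x| + \int[m2]_x `|w2 x|).
  have A0 : 0 <= A by rewrite addr_ge0// Rintegral_ge0.
  pose N := (Num.truncn (A / e)).+1.
  have AN : A / e < N%:R by exact: truncnS_gt.
  have N0 : 0 < N%:R :> R by rewrite ltr0n.
  have b1 := bnd _ _ m1 X1 w1 N mX1 iw1 isT.
  have b2 := bnd _ _ m2 X2 w2 N mX2 iw2 isT.
  rewrite eqN in b1.
  have bA : N%:R^-1 * A <= e.
    by rewrite mulrC ler_pdivrMr// mulrC -ler_pdivrMr// ltW.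
  apply: le_trans bA; rewrite /A mulrDr.
  apply: le_trans (lerD b1 b2).
  set u := (X in `|X - _| <= _); set v := (X in `|_ - X| <= _).
  set s := (\int[m2]_x (gN N (X2 x) * w2 x)).
  have -> : u - v = (u - s) - (v - s) by ring.
  exact: ler_normB.
move=> mf fC.
(* The shift by C makes f nonnegative. It adds C times the integral of the weight, which is the same
   on both sides by [hB] for the whole line. *)
pose K := (Num.truncn (2 * C)).+1.
have := pos (fun x => f x + C) K (measurable_funD mf (measurable_cst _)).
have fK x : 0 <= f x + C <= K%:R.
  have := fC x; rewrite ler_norml => /andP[h1 h2].
  have := truncnS_gt (2 * C); rewrite -/K => h3.
  by apply/andP; split; lra.
move=> /(_ fK).
have expand (d : measure_display) (T : measurableType d)
    (m : {measure set T -> \bar R}) (X w : T -> R) :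
    measurable_fun setT X -> m.-integrable setT (EFin \o w) ->
  \int[m]_x ((f (X x) + C) * w x) = \int[m]_x (f (X x) * w x) + C * \int[m]_x w x.
  move=> mX iw; rewrite -RintegralZl// -RintegralD//.
  - by apply: eq_Rintegral => x _; rewrite mulrDl.
  - apply: (@integrable_bounded_mul _ _ _ _ _ (f \o X) w C) => //.
      exact: measurableT_comp.
    by move=> x _; exact: fC.
  - exact: integrable_scale.
rewrite (expand _ _ m1)// (expand _ _ m2)//.
have := hB _ measurableT.
under eq_Rintegral do rewrite indicT mul1r.
under [X in _ = X -> _]eq_Rintegral do rewrite indicT mul1r.
by move=> ->; exact: addIr.
Qed.

Lemma trig_bound (R : realType) (A B x : R) :
  `|A * cos x + B * sin x| <= `|A| + `|B|.
Proof.
apply: (le_trans (ler_normD _ _)); rewrite !normrM.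
by apply: lerD; rewrite -[leRHS]mulr1 ler_wpM2l// ?cos_max ?sin_max// ler_norml
  ?cos_geN1 ?cos_le1 ?sin_geN1 ?sin_le1.
Qed.

Lemma measurable_trig (R : realType) (A B : R) :
  measurable_fun setT (fun x : R => A * cos x + B * sin x).
Proof.
apply: continuous_measurable_fun => x; apply: cvgD.
  by apply: cvgM; [exact: cvg_cst|exact: continuous_cos].
by apply: cvgM; [exact: cvg_cst|exact: continuous_sin].
Qed.

(** * The characteristic function of independent standard normal variables *)

Lemma standard_normal_pdfE (R : realType) (x : R) :
  normal_pdf 0 1 x = normal_peak 1 * expR (- (x ^+ 2 / 2)).
Proof.
by rewrite normal_pdfE ?oner_eq0//= /normal_fun subr0 expr1n mulNr.
Qed.

Lemma is_derive_standard_normal_pdf (R : realType) (x : R) :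
  is_derive x 1 (normal_pdf 0 1) (- (x * normal_pdf 0 1 x)).
Proof.
rewrite [X in is_derive _ _ X](_ : _ =
  fun x : R => normal_peak 1 * expR (- (x ^+ 2 / 2))); last first.
  by apply/funext => y; exact: standard_normal_pdfE.
have D : is_derive x (1 : R) (fun y : R => - (y ^+ 2 / 2)) (- x).
  by apply: is_derive_eq; rewrite /= /GRing.scale /=; field.
have D2 := @is_derive1_comp R expR (fun y : R => - (y ^+ 2 / 2)) x _ _
  (is_derive_expR _) D.
rewrite standard_normal_pdfE; apply: (is_derive_eq (is_deriveZ (normal_peak 1 : R) D2)).
by rewrite /= /GRing.scale /=; ring.
Qed.

(** The differential equation for the Gaussian integral is derived on [- N, N], where continuity
    gives integrability; this lemma removes the truncation. *)
Lemma cvg_Rintegral_itvNn (R : realType) (f : R -> R) :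
  (@lebesgue_measure R).-integrable setT (EFin \o f) ->
  (\int[lebesgue_measure]_(x in `[- n%:R, n%:R]) f x) @[n --> \oo] -->
  \int[lebesgue_measure]_x f x.
Proof.
move=> fi.
have mf : measurable_fun setT f by apply/measurable_EFinP; exact: measurable_int fi.
pose h (n : nat) (x : R) : \bar R := ((f \_ `[- n%:R, n%:R]) x)%:E.
have mh n : measurable_fun setT (h n).
  apply/measurable_EFinP; apply/(measurable_restrictT f) => //.
  exact: measurable_funTS.
have [||||_ _ H] := @dominated_convergence _ _ _ (@lebesgue_measure R) setT
  measurableT h (EFin \o f) (fun x => `|f x|%:E) mh _ _ _ _.
- exact/measurable_EFinP.
- apply: aeW => x _; apply/fine_cvgP; split; first exact: nearW.
  rewrite /h /comp/=; apply: cvg_near_cst.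
  near=> n; rewrite patchE ifT// inE/= in_itv/= -ler_norml.
  by near: n; exact: nbhs_infty_ger.
- exact: integrable_norm.
- apply: aeW => x n _; rewrite /h lee_fin patchE.
  by case: ifPn => // _; rewrite normr0.
- have Hfin : (\int[lebesgue_measure]_x (f x)%:E)%E \is a fin_num.
    exact: integrable_fin_num.
  rewrite [X in X @ _ --> _](_ : _ =
      fun n => fine (\int[lebesgue_measure]_x h n x)%E); last first.
    by apply/funext => n; rewrite [LHS]Rintegral_mkcond.
  by apply: fine_cvg; rewrite fineK.
Unshelve. all: by end_near. Qed.

Section normal_trig.
Variables (R : realType) (A B : R).
Local Notation phi := (normal_pdf 0 1 : R -> R).
Local Notation lam := (@lebesgue_measure R).

(** [dg] is the derivative of [g] in a, and [k] is a primitive in x of a g + dg. Hence the integral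
    u of [g] over [- N, N] satisfies u' + a u = boundary terms, the equation of exp(- a^2/2) up to
    an error. Sine is carried along with cosine because the addition formulas mix them in the
    induction on independent variables. *)
Let g (a x : R) : R := (A * cos (a * x) + B * sin (a * x)) * phi x.
Let dg (a x : R) : R := x * (B * cos (a * x) - A * sin (a * x)) * phi x.
Let k (a x : R) : R := (A * sin (a * x) - B * cos (a * x)) * phi x.

Let phi_ge0 (x : R) : 0 <= phi x. Proof. exact: normal_pdf_ge0. Qed.

Let phi_ub (x : R) : phi x <= normal_peak 1.
Proof. by apply: normal_pdf_ub; rewrite oner_eq0. Qed.

Let derivable_continuous (f : R -> R) : (forall x : R, derivable f x 1) -> continuous f.
Proof.
by move=> df x; apply: differentiable_continuous; apply/derivable1_diffP.
Qed.

Let is_derive_linear (a x : R) : is_derive x (1 : R) (fun y : R => a * y) a.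
Proof. by apply: is_derive_eq; rewrite /= /GRing.scale /=; ring. Qed.

Let is_derive_cosl (a x : R) :
  is_derive x (1 : R) (fun y : R => cos (a * y)) (- (a * sin (a * x))).
Proof.
apply: (is_derive_eq (@is_derive1_comp R cos (fun y : R => a * y) x _ _
  (is_derive_cos _) (is_derive_linear a x))).
by ring.
Qed.

Let is_derive_sinl (a x : R) :
  is_derive x (1 : R) (fun y : R => sin (a * y)) (a * cos (a * x)).
Proof.
apply: (is_derive_eq (@is_derive1_comp R sin (fun y : R => a * y) x _ _
  (is_derive_sin _) (is_derive_linear a x))).
by ring.
Qed.

Let is_derive_k (a x : R) : is_derive x 1 (k a) (a * g a x + dg a x).
Proof.
have D1 := is_derive_cosl a x; have D2 := is_derive_sinl a x.
have D3 := is_derive_standard_normal_pdf R x.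
by apply: is_derive_eq; rewrite /= /GRing.scale /= /g /dg; ring.
Qed.

Let is_derive_g1 (a x : R) : is_derive a 1 (g ^~ x) (dg a x).
Proof.
have E (f : R -> R) : (fun y : R => f (y * x)) = (fun y : R => f (x * y)).
  by apply/funext => y; rewrite mulrC.
have D1 := is_derive_cosl x a; have D2 := is_derive_sinl x a.
rewrite -E in D1; rewrite -E in D2.
by apply: is_derive_eq; rewrite /= /GRing.scale /= /dg [x * a]mulrC; ring.
Qed.

Let derivable_g2 (a x : R) : derivable (g a) x 1.
Proof.
have D1 := is_derive_cosl a x; have D2 := is_derive_sinl a x.
have D3 := is_derive_standard_normal_pdf R x.
by apply: (@ex_derive _ _ _ _ _ _ _ _); apply: is_derive_eq.
Qed.

Let continuous_g (a : R) : continuous (g a).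
Proof. exact/derivable_continuous/derivable_g2. Qed.

Let derivable_dg2 (a x : R) : derivable (dg a) x 1.
Proof.
have D1 := is_derive_cosl a x; have D2 := is_derive_sinl a x.
have D3 := is_derive_standard_normal_pdf R x.
by apply: (@ex_derive _ _ _ _ _ _ _ _); apply: is_derive_eq.
Qed.

Let continuous_dg (a : R) : continuous (dg a).
Proof. exact/derivable_continuous/derivable_dg2. Qed.

Let integrable_itv (f : R -> R) (N : R) : continuous f ->
  lam.-integrable `[- N, N] (EFin \o f).
Proof.
move=> cf; apply: continuous_compact_integrable; first exact: segment_compact.
exact: continuous_subspaceT.
Qed.

Let u (N a : R) : R := \int[lam]_(x in `[- N, N]) g a x.

Let is_derive_u (N a : R) : is_derive a 1 (u N) (\int[lam]_(x in `[- N, N]) dg a x).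
Proof.
have Ia : `]a - 1, a + 1[%classic a.
  by rewrite /= in_itv/=; apply/andP; split; lra.
(* A majorant of the derivative in the parameter that does not depend on the parameter. *)
pose G (x : R) : R := `|x| * (`|A| + `|B|) * normal_peak 1.
have cG : continuous G.
  move=> x; apply: cvgM; last exact: cvg_cst.
  by apply: cvgM; [exact: norm_continuous|exact: cvg_cst].
have G0 x : 0 <= G x.
  by rewrite /G !mulr_ge0 ?addr_ge0// normal_peak_ge0.
have d1E b x : partial1of2 g b x = dg b x.
  by rewrite partial1of2E (@derive_val _ _ _ _ _ _ _ (is_derive_g1 b x)).
have bG b x : `]a - 1, a + 1[%classic b -> `[- N, N]%classic x ->
    `|partial1of2 g b x| <= G x.
  move=> _ _; rewrite d1E /dg /G 2!normrM.
  rewrite ler_pM ?mulr_ge0//; last by rewrite ger0_norm.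
  rewrite ler_wpM2l//; have := trig_bound R B (- A) (b * x).
  by rewrite normrN mulNr addrC [`|B| + _]addrC.
have ig b : `]a - 1, a + 1[%classic b -> lam.-integrable `[- N, N] (EFin \o g b).
  by move=> _; exact: integrable_itv.
have dd b x : `]a - 1, a + 1[%classic b -> `[- N, N]%classic x ->
    derivable (g ^~ x) b 1.
  by move=> _ _; exact: (@ex_derive _ _ _ _ _ _ _ (is_derive_g1 b x)).
have mI : measurable (`[- N, N]%classic : set R) by exact: measurable_itv.
have H := @derivable_under_integral R _ _ lam g _ mI a (a - 1) (a + 1) Ia ig dd G G0 (integrable_itv _ _ cG) bG.
have H' := @differentiation_under_integral R _ _ lam g _ mI a (a - 1) (a + 1) Ia ig dd G G0 (integrable_itv _ _ cG) bG.
apply: DeriveDef => //; rewrite -derive1E H'.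
by apply: eq_Rintegral => x _; rewrite d1E.
Qed.

Let ode_u (N a : R) : 0 < N ->
  a * u N a + \int[lam]_(x in `[- N, N]) dg a x = k a N - k a (- N).
Proof.
move=> N0.
have ck : continuous (k a).
  by apply: derivable_continuous => x; exact: (@ex_derive _ _ _ _ _ _ _ (is_derive_k a x)).
have cf : continuous (fun x => a * g a x + dg a x).
  move=> x; apply: cvgD; last exact: continuous_dg.
  by apply: cvgM; [exact: cvg_cst|exact: continuous_g].
have mI : measurable (`[- N, N]%classic : set R) by exact: measurable_itv.
rewrite /u -RintegralZl//; last exact: integrable_itv.
rewrite -RintegralD//; last 2 first.
- by apply: integrable_scale => //; exact: integrable_itv.
- exact: integrable_itv.
rewrite /Rintegral (@continuous_FTC2 _ _ (k a))//.
- by lra.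
- exact: continuous_subspaceT.
- split.
  + by move=> x _; exact: (@ex_derive _ _ _ _ _ _ _ (is_derive_k a x)).
  + exact/cvg_at_right_filter/ck.
  + exact/cvg_at_left_filter/ck.
- by move=> x _; rewrite derive1E (@derive_val _ _ _ _ _ _ _ (is_derive_k a x)).
Qed.

(** The factor exp(a^2/2) leaves only the boundary terms in the derivative. Each is at most (|A| +
    |B|) phi N, and the mean value theorem on [0, a] concludes. *)
Let u_bound (N a : R) : 0 < N -> 0 <= a ->
  `|expR (a ^+ 2 / 2) * u N a - u N 0| <=
  expR (a ^+ 2 / 2) * (2 * (`|A| + `|B|)) * a * phi N.
Proof.
move=> N0 a0.
pose v (b : R) : R := expR (b ^+ 2 / 2) * u N b.
pose dv (b : R) : R := expR (b ^+ 2 / 2) * (k b N - k b (- N)).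
have dvE (b : R) : is_derive b 1 v (dv b).
  have D1 : is_derive b (1 : R) (fun y : R => y ^+ 2 / 2) b.
    by apply: is_derive_eq; rewrite /= /GRing.scale /=; field.
  have D2 := @is_derive1_comp R expR (fun y : R => y ^+ 2 / 2) b _ _
    (is_derive_expR _) D1.
  have D3 := is_deriveM D2 (is_derive_u N b).
  apply: (is_derive_eq D3); rewrite /= /GRing.scale /= /dv -ode_u//; ring.
have -> : u N 0 = v 0 by rewrite /v expr0n mul0r expR0 mul1r.
have [|b] := @MVT_segment R v dv 0 a a0 (fun x _ => dvE x).
  apply: continuous_subspaceT; apply: derivable_continuous => x.
  exact: (@ex_derive _ _ _ _ _ _ _ (dvE x)).
rewrite in_itv/= => /andP[b0 ba]; rewrite subr0 -/(v a) => ->.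
rewrite normrM (ger0_norm a0) mulrAC ler_wpM2r//.
rewrite /dv normrM (ger0_norm (expR_ge0 _)) -[leRHS]mulrA.
rewrite ler_pM ?expR_ge0//.
  by rewrite ler_expR ler_pM2r ?invr_gt0// lerXn2r.
have kb x : `|k b x| <= (`|A| + `|B|) * phi x.
  rewrite /k normrM (ger0_norm (phi_ge0 x)) ler_wpM2r//.
  by have := trig_bound R (- B) A (b * x); rewrite normrN mulNr addrC [`|B| + _]addrC.
apply: (le_trans (ler_normB _ _)).
have -> : 2 * (`|A| + `|B|) * phi N =
    (`|A| + `|B|) * phi N + (`|A| + `|B|) * phi (- N).
  rewrite (_ : phi (- N) = phi N); first by ring.
  by rewrite !standard_normal_pdfE sqrrN.
exact: lerD.
Qed.

Let integrable_g (a : R) : lam.-integrable setT (EFin \o g a).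
Proof.
have tb x : [set: R] x -> `|A * cos (a * x) + B * sin (a * x)| <= `|A| + `|B|.
  by move=> _; exact: trig_bound.
have ml : measurable_fun setT (fun x : R => a * x) by exact: measurable_funM.
exact: (@integrable_bounded_mul _ _ R lam setT _ phi _ measurableT
  (measurableT_comp (measurable_trig R A B) ml) tb (integrable_normal_pdf 0 1)).
Qed.

Let cvg_phi : phi n%:R @[n --> \oo] --> (0 : R).
Proof.
(* The majorant comes from (n - 1)^2 >= 0, that is - n^2/2 <= 1/2 - n. *)
have H : (normal_peak 1 * expR 2^-1 * expR (- n%:R) : R) @[n --> \oo] --> (0 : R).
  rewrite -[X in _ --> X](mulr0 (normal_peak 1 * expR 2^-1)).
  by apply: cvgM; [exact: cvg_cst|exact: cvgn_expR].
apply: (@squeeze_cvgr _ _ _ _ (fun=> 0) _ _ _ _ _ H); last exact: cvg_cst.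
near=> n; rewrite phi_ge0/= standard_normal_pdfE -mulrA -expRD.
rewrite ler_wpM2l ?normal_peak_ge0// ler_expR.
have := sqr_ge0 (n%:R - 1 : R); rewrite sqrrB expr1n mulr1; lra.
Unshelve. all: by end_near. Qed.

Lemma normal_trig_integral_pos (a : R) : 0 <= a ->
  \int[lam]_x ((A * cos (a * x) + B * sin (a * x)) * phi x) =
  A * expR (- (a ^+ 2 / 2)).
Proof.
move=> a0.
have c1 := cvg_Rintegral_itvNn _ _ (integrable_g a).
have c0 := cvg_Rintegral_itvNn _ _ (integrable_g 0).
have g0 : \int[lam]_x g 0 x = A.
  rewrite /g; under eq_Rintegral do rewrite mul0r cos0 sin0 mulr1 mulr0 addr0.
  rewrite RintegralZl//; last exact: integrable_normal_pdf.
  by rewrite /Rintegral integral_normal_pdf mulr1.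
rewrite g0 in c0.
have C : (expR (a ^+ 2 / 2) * u n%:R a - u n%:R 0) @[n --> \oo] -->
    expR (a ^+ 2 / 2) * \int[lam]_x g a x - A.
  by apply: cvgB => //; apply: cvgM => //; exact: cvg_cst.
have C0 : (expR (a ^+ 2 / 2) * u n%:R a - u n%:R 0) @[n --> \oo] --> (0 : R).
  apply: norm_cvg0.
  have H : (expR (a ^+ 2 / 2) * (2 * (`|A| + `|B|)) * a * phi n%:R) @[n --> \oo]
      --> (0 : R).
    rewrite -[X in _ --> X](mulr0 (expR (a ^+ 2 / 2) * (2 * (`|A| + `|B|)) * a)).
    by apply: cvgM; [exact: cvg_cst|exact: cvg_phi].
  apply: (@squeeze_cvgr _ _ _ _ (fun=> 0) _ _ _ _ _ H); last exact: cvg_cst.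
  near=> n; rewrite normr_ge0/= u_bound// ltr0n.
  by near: n; exact: nbhs_infty_gt.
have E : expR (a ^+ 2 / 2) * \int[lam]_x g a x - A = 0.
  by rewrite -(cvg_lim (@Rhausdorff R) C) (cvg_lim (@Rhausdorff R) C0).
move/eqP: E; rewrite subr_eq0 => /eqP E.
by rewrite -[X in _ = X * _]E mulrAC -expRD subrr expR0 mul1r.
Unshelve. all: by end_near. Qed.

End normal_trig.

Lemma normal_trig_integral (R : realType) (A B a : R) :
  \int[lebesgue_measure]_x ((A * cos (a * x) + B * sin (a * x)) * normal_pdf 0 1 x) =
  A * expR (- (a ^+ 2 / 2)).
Proof.
have [a0|a0] := leP 0 a; first exact: normal_trig_integral_pos.
rewrite -sqrrN -(@normal_trig_integral_pos R A (- B) (- a)) ?oppr_ge0 ?(ltW a0)//.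
by apply: eq_Rintegral => x _; rewrite mulNr cosN sinN mulrNN.
Qed.

Lemma measurable_sum_cond (d : measure_display) (T : measurableType d)
    (R : realType) (D : set T) (I : Type) (r : seq I) (p : pred I) (f : I -> T -> R) :
  (forall i, p i -> measurable_fun D (f i)) ->
  measurable_fun D (fun x => \sum_(i <- r | p i) f i x).
Proof.
move=> mf; elim: r => [|i r IH].
  rewrite (_ : (fun _ => _) = cst 0); first exact: measurable_cst.
  by apply/funext => x; rewrite big_nil.
set g := (X in measurable_fun D X) in IH.
rewrite (_ : (fun _ => _) = if p i then f i \+ g else g); last first.
  by apply/funext => x; rewrite big_cons; case: ifP.
by case: ifPn => // /mf mfi; exact: measurable_funD.
Qed.

Lemma measurable_prod_cond (d : measure_display) (T : measurableType d)
    (R : realType) (D : set T) (I : Type) (r : seq I) (p : pred I) (f : I -> T -> R) :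
  (forall i, p i -> measurable_fun D (f i)) ->
  measurable_fun D (fun x => \prod_(i <- r | p i) f i x).
Proof.
move=> mf; elim: r => [|i r IH].
  rewrite (_ : (fun _ => _) = cst 1); first exact: measurable_cst.
  by apply/funext => x; rewrite big_nil.
set g := (X in measurable_fun D X) in IH.
rewrite (_ : (fun _ => _) = if p i then f i \* g else g); last first.
  by apply/funext => x; rewrite big_cons; case: ifP.
by case: ifPn => // /mf mfi; exact: measurable_funM.
Qed.

Section iid_normal.
Variables (R : realType) (dT : measure_display) (T : measurableType dT).
Variables (P : probability T R) (I : finType) (X : I -> {RV P >-> R}).
Hypothesis hX : iid_standard_normal X.
Variable a : I -> R.

Let S (J : {set I}) (t : T) : R := \sum_(i in J) a i * X i t.
Let ind (J : {set I}) (B : I -> set R) (t : T) : R :=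
  \prod_(i | i \notin J) \1_(B i) (X i t).
Let s2 (J : {set I}) : R := \sum_(i in J) a i ^+ 2.
Let pr (J : {set I}) (B : I -> set R) : R :=
  \prod_(i | i \notin J) fine (P (X i @^-1` B i)).

Let measurable_S J : measurable_fun setT (S J).
Proof. by apply: measurable_sum_cond => i _; exact: measurable_funM. Qed.

Let measurable_ind J B : (forall i, measurable (B i)) ->
  measurable_fun setT (ind J B).
Proof.
move=> mB; apply: measurable_prod_cond => i _.
by apply: measurableT_comp => //; exact: measurable_indic.
Qed.

Let ind_bound J B t : 0 <= ind J B t <= 1.
Proof.
apply/andP; split.
  by apply: prodr_ge0 => i _; rewrite indicE.
by apply: prodr_ile1 => i _; rewrite indicE ler0n lern1 leq_b1.
Qed.

Let weight_integrable J B A C : (forall i, measurable (B i)) ->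
  P.-integrable setT (EFin \o (fun t => (A * cos (S J t) + C * sin (S J t)) * ind J B t)).
Proof.
move=> mB; apply: measurable_bounded_integrable => //.
- by apply: (le_lt_trans (probability_le1 P measurableT)); rewrite ltry.
- apply: measurable_funM; last exact: measurable_ind.
  exact: (measurableT_comp (measurable_trig R A C) (measurable_S J)).
- exists (`|A| + `|C|); split; first exact: num_real.
  move=> M CM t _ /=; apply: le_trans (ltW CM); rewrite normrM.
  rewrite -[leRHS]mulr1 ler_pM// ?trig_bound//.
  by have /andP[i0 i1] := ind_bound J B t; rewrite ger0_norm.
Qed.

Let distrE i (B : set R) : measurable B ->
  fine (P (X i @^-1` B)) = \int[lebesgue_measure]_x (\1_B x * normal_pdf 0 1 x).
Proof.
move=> mB; have := hX.2 i B mB; rewrite /distribution /pushforward => ->.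
rewrite /normal_prob -[LHS]/(Rintegral _ _ _) Rintegral_mkcond.
apply: eq_Rintegral => x _; rewrite patchE.
have [xB|xB] := boolP (x \in B).
  by rewrite [\1_B x]indicE xB mul1r.
by rewrite [\1_B x]indicE (negbTE xB) mul0r.
Qed.

Let O : {set I} := finset.set0.

(** With no variable in the sum, the product of all indicators is the indicator of an intersection,
    and the product formula defining independence applies to the full index set. *)
Let base B A C : (forall i, measurable (B i)) ->
  \int[P]_t ((A * cos (S O t) + C * sin (S O t)) * ind O B t) =
  A * expR (- (s2 O / 2)) * pr O B.
Proof.
move=> mB.
have S0 t : S O t = 0 by rewrite /S big_set0.
rewrite /s2 big_set0 mul0r oppr0 expR0 mulr1.
under eq_Rintegral do rewrite S0 cos0 sin0 mulr1 mulr0 addr0.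
have iB : P.-integrable setT (EFin \o ind O B).
  have := weight_integrable O B 1 0 mB.
  congr (_.-integrable _ _); apply/funext => t /=.
  by rewrite S0 cos0 sin0 !mul1r mul0r addr0 mul1r.
rewrite RintegralZl//; congr (_ * _).
have -> : \int[P]_t ind O B t =
    fine (P (\bigcap_(i in [set` [set: I]%SET]) (X i @^-1` B i))).
  set E := \bigcap_(_ in _) _.
  have mE : measurable E.
    by apply: fin_bigcap_measurable => [|i _]; [exact: finite_finset|exact: measurable_funPTI].
  have -> : fine (P E) = \int[P]_t \1_E t by rewrite /Rintegral integral_indic ?setIT.
  apply: eq_Rintegral => t _.
  rewrite /ind indicE.
  have [tB|tB] := boolP (t \in _).
    apply: big1 => i _; rewrite indicE mem_set//.
    by move/set_mem: tB => /(_ i); apply; rewrite /= inE.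
  have [i /negP tBi] : exists i, ~~ (X i t \in B i).
    apply/existsP; rewrite -negb_forall; apply: contra tB => /forallP h.
    by rewrite inE => i _; exact: (set_mem (h i)).
  by rewrite (bigD1 i) ?finset.in_set0//= indicE (negbTE (introN idP tBi)) mul0r.
rewrite (hX.1 [set: I]%SET B mB) /pr.
rewrite [in LHS](eq_bigl (fun i => i \notin O)); last first.
  by move=> i; rewrite finset.in_setT finset.in_set0.
rewrite [in LHS](eq_bigr (fun i => (fine (P (X i @^-1` B i)))%:E)); last first.
  by move=> i _; rewrite fineK// fin_num_measure// ; exact: measurable_funPTI.
by rewrite prodEFin.
Qed.

(* The variables indexed by J are integrated one at a time; the indicators of the
   other ones carry the independence through the induction. *)
Let main n : forall (J : {set I}) (B : I -> set R) (A C : R), #|J| = n -> (forall i, measurable (B i)) ->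
  \int[P]_t ((A * cos (S J t) + C * sin (S J t)) * ind J B t) =
  A * expR (- (s2 J / 2)) * pr J B.
Proof.
elim: n => [|n IH] J B A C Jn mB.
  by move/eqP: Jn; rewrite cards_eq0 => /eqP ->; exact: base.
have [i iJ] : exists i, i \in J by apply/card_gt0P; rewrite Jn.
pose K := J :\ i.
have Kn : #|K| = n by move: Jn; rewrite (cardsD1 i) iJ add1n => -[].
have iK : i \notin K by rewrite !inE eqxx.
have KJ k : (k \notin K) && (k != i) = (k \notin J).
  by rewrite !inE; case: eqVneq => [->|_] /=; rewrite ?iJ ?andbT.
have SJ t : S J t = a i * X i t + S K t by rewrite /S (big_setD1 i).
have s2J : s2 J = a i ^+ 2 + s2 K by rewrite /s2 (big_setD1 i).
(* Since i is outside K, its slot is free: placing D there lets the induction hypothesis see the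
   event that X i lies in D. *)
pose B' D k := if k == i then D else B k.
have mB' D k : measurable D -> measurable (B' D k).
  by move=> mD; rewrite /B'; case: ifP.
have indK D t : ind K (B' D) t = \1_D (X i t) * ind J B t.
  rewrite /ind (bigD1 i)//= {1}/B' eqxx; congr (_ * _).
  apply: eq_big => // k; rewrite KJ => kJ; rewrite /B' ifN//.
  by apply: contraNneq kJ => ->.
have prK D : pr K (B' D) = fine (P (X i @^-1` D)) * pr J B.
  rewrite /pr (bigD1 i)//= {1}/B' eqxx; congr (_ * _).
  apply: eq_big => // k; rewrite KJ => kJ; rewrite /B' ifN//.
  by apply: contraNneq kJ => ->.
pose w (A C : R) (t : T) : R := (A * cos (S K t) + C * sin (S K t)) * ind J B t.
have w_int (A' C' : R) : P.-integrable setT (EFin \o w A' C').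
  have := weight_integrable K (B' setT) A' C' (fun k => mB' _ k measurableT).
  congr (_.-integrable _ _); apply/funext => t /=.
  by rewrite indK indicT mul1r.
pose c (A : R) : R := A * expR (- (s2 K / 2)) * pr J B.
have phi_int (e : R) : (@lebesgue_measure R).-integrable setT
    (EFin \o (fun x => e * normal_pdf 0 1 x)).
  by apply: integrable_scale => //; exact: integrable_normal_pdf.
(* Under the signed weight w, X i still has a multiple of the normal law. On indicators this is the
   induction hypothesis for K and [B' D]; [eq_weighted_law] extends it to bounded functions. *)
have law (A' C' : R) (f : R -> R) (e : R) : measurable_fun setT f -> (forall x, `|f x| <= e) ->
    \int[P]_t (f (X i t) * w A' C' t) =
    \int[lebesgue_measure]_x (f x * (c A' * normal_pdf 0 1 x)).
  move=> mf fe.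
  suff hD D : measurable D -> \int[P]_t (\1_D (X i t) * w A' C' t) =
      \int[lebesgue_measure]_x (\1_D x * (c A' * normal_pdf 0 1 x)).
    exact: (@eq_weighted_law R _ _ _ _ P lebesgue_measure (X i) (w A' C') idfun
      (fun x => c A' * normal_pdf 0 1 x) f e (measurable_funP (X i))
      (@measurable_id _ _ setT) (w_int A' C') (phi_int (c A')) hD mf fe).
  move=> mD.
  transitivity (\int[P]_t ((A' * cos (S K t) + C' * sin (S K t)) * ind K (B' D) t)).
    by apply: eq_Rintegral => t _; rewrite indK /w mulrCA.
  rewrite IH//; last by move=> k; exact: mB'.
  rewrite prK distrE// mulrCA mulrC -RintegralZl//; last first.
    apply: (@integrable_bounded_mul _ _ R lebesgue_measure setT (\1_D) _ 1) => //.
    - by move=> x _; rewrite indicE normr_nat lern1 leq_b1.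
    - exact: integrable_normal_pdf.
  by apply: eq_Rintegral => x _; rewrite /c /=; ring.
pose f1 (x : R) := 1 * cos (a i * x) + 0 * sin (a i * x).
pose f2 (x : R) := 0 * cos (a i * x) + 1 * sin (a i * x).
have mf (C1 C2 : R) : measurable_fun setT (fun x : R => C1 * cos (a i * x) + C2 * sin (a i * x)).
  have ml : measurable_fun setT (fun x : R => a i * x) by exact: measurable_funM.
  exact: (measurableT_comp (measurable_trig R C1 C2) ml).
have L1 := law A C f1 (`|1| + `|0|) (mf 1 0) (fun x => trig_bound R 1 0 (a i * x)).
have L2 := law C (- A) f2 (`|0| + `|1|) (mf 0 1) (fun x => trig_bound R 0 1 (a i * x)).
have gauss (C1 C2 e : R) : \int[lebesgue_measure]_x
    ((C1 * cos (a i * x) + C2 * sin (a i * x)) * (e * normal_pdf 0 1 x)) =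
    e * (C1 * expR (- (a i ^+ 2 / 2))).
  rewrite -(normal_trig_integral R C1 C2) -RintegralZl//; last first.
    apply: (@integrable_bounded_mul _ _ R lebesgue_measure setT
      (fun x => C1 * cos (a i * x) + C2 * sin (a i * x)) _ (`|C1| + `|C2|)) => //.
    - exact: mf.
    - by move=> x _; exact: trig_bound.
    - exact: integrable_normal_pdf.
  by apply: eq_Rintegral => x _; rewrite mulrCA.
(* Addition formulas: the factor of sin (a i * X i) is C cos - A sin of the remaining sum, whence
   the weight [w C (- A)]. Its integral vanishes by oddness of sine. *)
transitivity (\int[P]_t (f1 (X i t) * w A C t + f2 (X i t) * w C (- A) t)).
  by apply: eq_Rintegral => t _; rewrite SJ cosD sinD /f1 /f2 /w; ring.
have fw_int (C1 C2 A' C' : R) : P.-integrable setT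
    (EFin \o (fun t => (C1 * cos (a i * X i t) + C2 * sin (a i * X i t)) * w A' C' t)).
  apply: (@integrable_bounded_mul _ _ R P setT
    (fun t => C1 * cos (a i * X i t) + C2 * sin (a i * X i t)) _ (`|C1| + `|C2|)) => //.
    exact: (measurableT_comp (mf C1 C2)).
  by move=> x _; exact: trig_bound.
rewrite (RintegralD measurableT (fw_int 1 0 A C) (fw_int 0 1 C (- A))) L1 L2 !gauss mul0r mulr0 addr0 mul1r s2J /c.
by rewrite mulrDl opprD expRD; ring.
Qed.

Lemma iid_normal_cos_sum :
  \int[P]_t cos (\sum_i a i * X i t) = expR (- ((\sum_i a i ^+ 2) / 2)).
Proof.
have s2T : s2 [set: I]%SET = \sum_i a i ^+ 2.
  by apply: eq_bigl => i; rewrite inE.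
have ST t : S [set: I]%SET t = \sum_i a i * X i t.
  by apply: eq_bigl => i; rewrite inE.
have prT : pr [set: I]%SET (fun=> setT) = 1.
  by rewrite /pr big_pred0// => i; rewrite inE.
have indT t : ind [set: I]%SET (fun=> setT) t = 1.
  by rewrite /ind big_pred0// => i; rewrite inE.
have := main #|[set: I]%SET| [set: I]%SET (fun=> setT) 1 0 erefl (fun=> measurableT).
rewrite prT s2T mul1r mulr1 => <-; apply: eq_Rintegral => t _.
by rewrite indT ST mul1r mul0r addr0 mulr1.
Qed.

End iid_normal.

(** * Moments of a Haar distributed orthogonal matrix *)

(** The integers below the size of p - q are distinct roots, too many for a nonzero polynomial. *)
Lemma horner_inj (R : numDomainType) (p q : {poly R}) :
  (forall x, p.[x] = q.[x]) -> p = q.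
Proof.
move=> pq; apply/eqP; rewrite -subr_eq0; apply/eqP.
pose rs := [seq n%:R : R | n <- iota 0 (size (p - q))].
apply: (@roots_geq_poly_eq0 _ _ rs); last by rewrite size_map size_iota.
  by apply/allP => x _; rewrite /root hornerD hornerN pq subrr.
rewrite map_inj_uniq ?iota_uniq// => m n /eqP.
by rewrite eqr_nat => /eqP.
Qed.

Lemma coef_1DXsqr (R : comNzRingType) (k : nat) :
  ((1 + 'X^2 : {poly R}) ^+ k)`_0 = 1 /\ ((1 + 'X^2 : {poly R}) ^+ k)`_2 = k%:R.
Proof.
elim: k => [|k [IH0 IH2]]; first by rewrite expr0 !coef1.
rewrite exprS mulrDl mul1r !coefD ![('X^2 * _)`_ _]coefXnM /= IH0 IH2.
by rewrite addr0 natr1.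
Qed.

Lemma dotcvE (R : realType) (d : nat) (u v : 'cV[R]_d) :
  dotcv u v = \sum_i u i 0 * v i 0.
Proof. by rewrite /dotcv mxE; apply: eq_bigr => i _; rewrite mxE. Qed.

Lemma dotcvC (R : realType) (d : nat) (u v : 'cV[R]_d) : dotcv u v = dotcv v u.
Proof. by rewrite !dotcvE; apply: eq_bigr => i _; rewrite mulrC. Qed.

Lemma dotcv_mulmx (R : realType) (d : nat) (A : 'M[R]_d) (u v : 'cV[R]_d) :
  dotcv (A *m u) v = dotcv u (A^T *m v).
Proof. by rewrite /dotcv trmx_mul mulmxA. Qed.

Lemma dotcvDr (R : realType) (d : nat) (u v w : 'cV[R]_d) :
  dotcv u (v + w) = dotcv u v + dotcv u w.
Proof. by rewrite /dotcv mulmxDr mxE. Qed.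

Lemma dotcvZr (R : realType) (d : nat) (a : R) (u v : 'cV[R]_d) :
  dotcv u (a *: v) = a * dotcv u v.
Proof. by rewrite /dotcv -scalemxAr mxE. Qed.

Lemma dotcv_delta (R : realType) (d : nat) (u : 'cV[R]_d) (i : 'I_d) :
  dotcv u (delta_mx i 0) = u i 0.
Proof.
rewrite dotcvE (bigD1 i)//= mxE !eqxx mulr1 big1 ?addr0// => j ji.
by rewrite mxE (negbTE ji) mulr0.
Qed.

Lemma dotcv_ge0 (R : realType) (d : nat) (u : 'cV[R]_d) : 0 <= dotcv u u.
Proof. by rewrite dotcvE; apply: sumr_ge0 => i _; rewrite -expr2 sqr_ge0. Qed.

Lemma dotcv_eq0 (R : realType) (d : nat) (u : 'cV[R]_d) : dotcv u u = 0 -> u = 0.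
Proof.
move=> /eqP; rewrite dotcvE psumr_eq0; last by move=> i _; rewrite -expr2 sqr_ge0.
move=> /allP h; apply/colP => i; rewrite mxE; apply/eqP.
by have := h i (mem_index_enum _); rewrite /= mulf_eq0 orbb.
Qed.

(** The reflection along u - v exchanges two vectors of equal norm. The transpose is the form in
    which [haar_law] uses Q. *)
Lemma householder (R : realType) (d : nat) (u v : 'cV[R]_d) :
  dotcv u u = dotcv v v ->
  exists2 Q : 'M[R]_d, orthogonal_group Q & Q^T *m u = v.
Proof.
move=> uv; have [<-|neq_uv] := eqVneq u v.
  by exists 1%:M; rewrite /orthogonal_group /= trmx1 mul1mx.
pose w := u - v; pose n := dotcv w w.
have n0 : n != 0.
  by apply: contra neq_uv => /eqP /dotcv_eq0 /eqP; rewrite subr_eq0.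
have ww : w^T *m w = n%:M by rewrite [LHS]mx11_scalar.
pose Q : 'M[R]_d := 1%:M - (2 / n) *: (w *m w^T).
have QT : Q^T = Q.
  by rewrite /Q linearB /= trmx1 linearZ /= trmx_mul trmxK.
exists Q; rewrite ?/orthogonal_group /= QT.
  rewrite /Q; set Z := (2 / n) *: (w *m w^T).
  have ZZ : Z *m Z = Z + Z.
    rewrite -scalemxAl -scalemxAr -mulmxA (mulmxA w^T) ww mul_scalar_mx -scalemxAr.
    by rewrite !scalerA -scalerDl; congr (_ *: _); field.
  rewrite mulmxBl mul1mx mulmxBr mulmx1 ZZ.
  have -> : Z - (Z + Z) = - Z by rewrite opprD addrA subrr add0r.
  by rewrite opprK subrK.
have wu : 2 * dotcv w u = n.
  have BB (x y z : 'cV[R]_d) : dotcv x (y - z) = dotcv x y - dotcv x z.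
    by rewrite dotcvDr -scaleN1r dotcvZr mulN1r.
  have wE x : dotcv w x = dotcv u x - dotcv v x.
    by rewrite ![dotcv _ x]dotcvC BB.
  by rewrite /n [in RHS]/w BB !wE uv (dotcvC R d v u); ring.
rewrite /Q mulmxBl mul1mx -scalemxAl -mulmxA [w^T *m u]mx11_scalar.
rewrite -/(dotcv w u) mul_mx_scalar scalerA.
have -> : 2 / n * dotcv w u = 1 by rewrite mulrAC wu divff.
by rewrite scale1r /w opprB addrC subrK.
Qed.

Lemma measurable_coord (R : realType) (d : nat) (i j : 'I_d) :
  measurable_fun setT (fun A : borelType 'M[R]_d => (A : 'M[R]_d) i j).
Proof.
apply: (measurability _ (RGenOpens.measurableE R)) => //.
move=> _ [_ [x [y ->] <-]]; rewrite setTI; apply: sub_sigma_algebra.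
move: (@coord_continuous R d d i j) => /continuousP; apply.
exact: interval_open.
Qed.

Lemma measurable_dotcv_mulmx (R : realType) (d : nat) (b u : 'cV[R]_d) :
  measurable_fun setT (fun A : borelType 'M[R]_d => dotcv ((A : 'M[R]_d) *m b) u).
Proof.
rewrite [X in measurable_fun _ X](_ : _ = fun A : borelType 'M[R]_d =>
    \sum_i (\sum_j (A : 'M[R]_d) i j * b j 0) * u i 0).
  apply: measurable_sum_cond => i _; apply: measurable_funM => //.
  apply: measurable_sum_cond => j _; apply: measurable_funM => //.
  exact: measurable_coord.
by apply/funext => A; rewrite dotcvE; apply: eq_bigr => i _; rewrite mxE.
Qed.

Lemma measurable_orthogonal_group (R : realType) (d : nat) :
  measurable (@orthogonal_group R d : set (borelType 'M[R]_d)).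
Proof.
rewrite (_ : @orthogonal_group R d = \bigcap_(ij in [set: 'I_d * 'I_d])
  ((fun A : borelType 'M[R]_d => \sum_k (A : 'M[R]_d) k ij.1 * (A : 'M[R]_d) k ij.2)
    @^-1` [set (ij.1 == ij.2)%:R])).
  apply: fin_bigcap_measurable => [|[i j] _]; first exact: finite_finset.
  rewrite -[X in measurable X]setTI.
  have mf : measurable_fun setT (fun A : borelType 'M[R]_d =>
      \sum_k (A : 'M[R]_d) k i * (A : 'M[R]_d) k j).
    apply: measurable_sum_cond => k _; apply: measurable_funM; exact: measurable_coord.
  by apply: mf => //; exact: measurable_set1.
apply/seteqP; split => [A|A].
  move=> /= AO [i j] _ /=.
  have /(congr1 (fun B : 'M[R]_d => B i j)) := AO.
  rewrite !mxE => <-; apply: eq_bigr => k _; by rewrite mxE.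
move=> h; apply/matrixP => i j; have /= := h (i, j) I.
by rewrite !mxE => <-; apply: eq_bigr => k _; rewrite mxE.
Qed.

Lemma orthogonal_entry_bound (R : realType) (d : nat) (A : 'M[R]_d) (i j : 'I_d) :
  orthogonal_group A -> `|A i j| <= 1.
Proof.
move=> /(congr1 (fun B : 'M[R]_d => B j j)); rewrite !mxE eqxx => AO.
rewrite -(@expr_le1 _ 2)// real_normK ?num_real// -[leRHS]/(true%:R) -AO (bigD1 i)//= mxE -expr2.
rewrite lerDl; apply: sumr_ge0 => k _; by rewrite mxE -expr2 sqr_ge0.
Qed.

Lemma orthogonal_mul (R : realType) (d : nat) (A B : 'M[R]_d) :
  orthogonal_group A -> orthogonal_group B -> orthogonal_group (A *m B).
Proof.
rewrite /orthogonal_group /= => hA hB.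
by rewrite trmx_mul -mulmxA (mulmxA A^T) hA mul1mx hB.
Qed.

Lemma orthogonal_tr (R : realType) (d : nat) (A : 'M[R]_d) :
  orthogonal_group A -> orthogonal_group A^T.
Proof. by rewrite /orthogonal_group /= trmxK; exact: mulmx1C. Qed.

Lemma orthogonal_dotcv (R : realType) (d : nat) (A : 'M[R]_d) (b : 'cV[R]_d) :
  orthogonal_group A -> dotcv (A *m b) (A *m b) = dotcv b b.
Proof. by move=> AO; rewrite dotcv_mulmx mulmxA AO mul1mx. Qed.

Section haar.
Variables (R : realType) (d : nat) (dO : measure_display) (TO : measurableType dO).
Variables (PO : probability TO R) (M : {RV PO >-> borelType 'M[R]_d}).
Hypothesis hM : is_haar_orthogonal (distribution PO M).

Local Notation O := (@orthogonal_group R d : set (borelType 'M[R]_d)).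
(** M is orthogonal only almost surely. The moments are integrated against the indicator of D, where
    [ev] is bounded because the entries of M are; [haar_cos_dotcv] removes the indicator. *)
Let D : set TO := M @^-1` O.
Let ev (b u : 'cV[R]_d) (t : TO) : R := dotcv ((M t : 'M[R]_d) *m b) u.
Let bnd (b u : 'cV[R]_d) : R := \sum_i (\sum_j `|b j 0|) * `|u i 0|.

Let mD : measurable D.
Proof. by apply: measurable_funPTI; exact: measurable_orthogonal_group. Qed.

Let PD : PO D = 1%E. Proof. exact: hM.1. Qed.

Let mev b u : measurable_fun setT (ev b u).
Proof.
exact: (measurableT_comp (measurable_dotcv_mulmx R d b u) (measurable_funP M)).
Qed.

Let ev_bound b u t : D t -> `|ev b u t| <= bnd b u.
Proof.
move=> Dt; rewrite /ev dotcvE; apply: (le_trans (ler_norm_sum _ _ _)).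
apply: ler_sum => i _; rewrite normrM ler_wpM2r// mxE.
apply: (le_trans (ler_norm_sum _ _ _)); apply: ler_sum => j _.
by rewrite normrM ler_piMl// (orthogonal_entry_bound R d).
Qed.

Let bnd_ge0 b u : 0 <= bnd b u.
Proof. by apply: sumr_ge0 => i _; rewrite mulr_ge0// sumr_ge0. Qed.

Let D_integrable (f : TO -> R) (C : R) : measurable_fun setT f ->
  (forall t, D t -> `|f t| <= C) ->
  PO.-integrable setT (EFin \o (fun t => f t * \1_D t)).
Proof.
move=> mf fC; apply: measurable_bounded_integrable => //.
- by apply: (le_lt_trans (probability_le1 PO measurableT)); rewrite ltry.
- by apply: measurable_funM => //; exact: measurable_indic.
- exists `|C|; split; first exact: num_real.
  move=> N CN t _ /=; apply: le_trans (ltW CN); rewrite indicE.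
  have [/set_mem tD|_] := boolP (t \in D); rewrite ?mulr1 ?mulr0 ?normr0//.
  by apply: (le_trans (fC _ tD)); exact: ler_norm.
Qed.

Let indD_integrable : PO.-integrable setT (EFin \o (\1_D : TO -> R)).
Proof. exact: integrable_indic. Qed.

Let intD : \int[PO]_t \1_D t = 1.
Proof.
transitivity (fine (PO D)); last by rewrite PD.
by rewrite /Rintegral integral_indic// setIT.
Qed.

(** As (M b) . (Q^T u) = (Q M b) . u, the event on the left says that Q M lies in a set A, that is,
    M in the image of A by Q^T. Invariance is therefore applied to Q^T. *)
Let haar_law (Q : 'M[R]_d) (b u : 'cV[R]_d) (B : set R) : orthogonal_group Q ->
  measurable B ->
  \int[PO]_t (\1_B (ev b (Q^T *m u) t) * \1_D t) = \int[PO]_t (\1_B (ev b u t) * \1_D t).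
Proof.
move=> QO mB.
have mm v : measurable (ev b v @^-1` B `&` D).
  apply: measurableI => //; rewrite -[X in measurable X]setTI; exact: mev.
have E v : \int[PO]_t (\1_B (ev b v t) * \1_D t) = fine (PO (ev b v @^-1` B `&` D)).
  transitivity (\int[PO]_t \1_(ev b v @^-1` B `&` D) t).
    apply: eq_Rintegral => t _; rewrite indicI/=; congr (_ * _).
  by rewrite /Rintegral integral_indic// setIT.
rewrite !E; congr fine.
pose A : set (borelType 'M[R]_d) :=
  (fun N : borelType 'M[R]_d => dotcv ((N : 'M[R]_d) *m b) u) @^-1` B `&` O.
have mA : measurable A.
  apply: measurableI; last exact: measurable_orthogonal_group.
  rewrite -[X in measurable X]setTI; exact: measurable_dotcv_mulmx.
have := hM.2 Q^T A (orthogonal_tr R d Q QO) mA.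
rewrite /distribution /pushforward => h.
rewrite [RHS](_ : _ = PO (M @^-1` A))// -h; congr (PO _).
apply/seteqP; split => t.
  move=> [Bt Dt]; exists (Q *m (M t : 'M[R]_d)).
    split; last exact: orthogonal_mul.
    by rewrite /= -mulmxA dotcv_mulmx.
  by rewrite mulmxA QO mul1mx.
move=> [N [BN NO] QN]; split; last first.
  rewrite /D /= -QN.
  by apply: orthogonal_mul => //; exact: orthogonal_tr.
  rewrite /= /ev -QN -mulmxA dotcv_mulmx trmxK mulmxA (mulmx1C QO) mul1mx.
  exact: BN.
Qed.


Let mom (b : 'cV[R]_d) (m : nat) (u : 'cV[R]_d) : R :=
  \int[PO]_t (ev b u t ^+ m * \1_D t).

Let eq_onD (f g : TO -> R) : (forall t, D t -> f t = g t) ->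
  \int[PO]_t (f t * \1_D t) = \int[PO]_t (g t * \1_D t).
Proof.
move=> fg; apply: eq_Rintegral => t _; rewrite indicE.
by have [/set_mem /fg ->|_] := boolP (t \in D); rewrite ?mulr0.
Qed.

Let mom_inv b m u v : dotcv u u = dotcv v v -> mom b m u = mom b m v.
Proof.
move=> /householder[Q QO Quv]; pose C := bnd b u + bnd b v.
have C0 : 0 <= C by rewrite addr_ge0.
(* The power is truncated because eq_weighted_law needs a bounded function. *)
pose f (x : R) : R := x ^+ m * \1_(`[- C, C]%classic) x.
have mf : measurable_fun setT f.
  apply: measurable_funM; first exact: measurable_funX.
  by apply: measurable_indic; exact: measurable_itv.
have fC x : `|f x| <= C ^+ m.
  rewrite /f normrM indicE normr_nat.
  have [/set_mem|_] := boolP (x \in _); last by rewrite mulr0 exprn_ge0.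
  rewrite /= in_itv/= -ler_norml => xC.
  by rewrite mulr1 normrX lerXn2r.
have clip w : bnd b w <= C ->
    mom b m w = \int[PO]_t (f (ev b w t) * \1_D t).
  move=> wC; apply: eq_onD => t Dt; rewrite /f indicE mem_set ?mulr1//.
  by rewrite /= in_itv/= -ler_norml (le_trans (ev_bound b w t Dt)).
rewrite !clip ?lerDl ?lerDr//.
apply: (eq_weighted_law R _ _ _ _ PO PO _ _ _ _ f (C ^+ m)) => // B mB.
by rewrite -Quv haar_law.
Qed.

Variable i0 : 'I_d.
Let e (i : 'I_d) : 'cV[R]_d := delta_mx i 0.
Let mu (b : 'cV[R]_d) (k : nat) : R := mom b k.*2 (e i0).

Let evD b u v t : ev b (u + v) t = ev b u t + ev b v t.
Proof. exact: dotcvDr. Qed.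

Let evZ b c u t : ev b (c *: u) t = c * ev b u t.
Proof. exact: dotcvZr. Qed.

Let dotcv_e i j : dotcv (e i) (e j) = (i == j)%:R.
Proof. by rewrite /e dotcv_delta mxE eqxx andbT eq_sym. Qed.

Let pow_integrable b u v m l : PO.-integrable setT
  (EFin \o (fun t => ev b u t ^+ m * ev b v t ^+ l * \1_D t)).
Proof.
apply: (D_integrable (fun t => ev b u t ^+ m * ev b v t ^+ l)
  (bnd b u ^+ m * bnd b v ^+ l)).
  by apply: measurable_funM; apply: measurable_funX; exact: mev.
move=> t Dt; rewrite normrM !normrX.
by apply: ler_pM; rewrite ?exprn_ge0//; apply: lerXn2r;
  rewrite ?nnegrE//; exact: ev_bound.
Qed.

Let mom_radial b k u : mom b k.*2 u = dotcv u u ^+ k * mu b k.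
Proof.
pose c := Num.sqrt (dotcv u u).
have c2 : c ^+ 2 = dotcv u u by rewrite sqr_sqrtr// dotcv_ge0.
rewrite (mom_inv b _ u (c *: e i0)); last first.
  by rewrite dotcvZr dotcvC dotcvZr dotcv_e eqxx mulr1 -expr2.
rewrite /mu /mom -RintegralZl//; last first.
  have := pow_integrable b (e i0) (e i0) k.*2 0.
  by congr (_.-integrable _ _); apply/funext => t /=; rewrite expr0 mulr1.
apply: eq_Rintegral => t _.
by rewrite evZ exprMn -mul2n exprM c2 mulrA.
Qed.

(* Compare the coefficients of s^2 in the polynomial identity
   E (v_0 + s v_i)^(2k+2) = mu_(k+1) (1 + s^2)^(k+1), where v = M b. *)
Let mixed_moment b k i : i != i0 ->
  (k.*2.+1)%:R * \int[PO]_t (ev b (e i0) t ^+ k.*2 * ev b (e i) t ^+ 2 * \1_D t) =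
  mu b k.+1.
Proof.
move=> ii0; pose m := k.+1.*2.
pose c l := \int[PO]_t (ev b (e i0) t ^+ (m - l) * ev b (e i) t ^+ l * \1_D t).
pose p : {poly R} := \poly_(l < m.+1) ('C(m, l)%:R * c l).
pose q : {poly R} := mu b k.+1 *: (1 + 'X^2) ^+ k.+1.
have /(congr1 (fun r : {poly R} => r`_2)) : p = q.
  apply: horner_inj => s; rewrite /q hornerZ horner_exp hornerD hornerC hornerXn.
  have <- : dotcv (e i0 + s *: e i) (e i0 + s *: e i) = 1 + s ^+ 2.
    rewrite dotcvDr dotcvZr ![dotcv (_ + _) _]dotcvC !dotcvDr !dotcvZr !dotcv_e.
    by rewrite !eqxx (negbTE ii0) eq_sym (negbTE ii0) mulr0 addr0 add0r mulr1 expr2.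
  rewrite mulrC -mom_radial /p horner_poly /mom.
  under [RHS]eq_Rintegral do rewrite evD evZ exprDn mulr_suml.
  rewrite Rintegral_sum//; last first.
    move=> l _; have := integrable_scale _ _ _ PO setT _ ('C(m, l)%:R * s ^+ l)
      measurableT (pow_integrable b (e i0) (e i) (m - l) l).
    congr (_.-integrable _ _); apply/funext => t /=.
    by congr EFin; rewrite exprMn -mulr_natl; ring.
  apply: eq_bigr => l _; rewrite mulrAC /c -RintegralZl//.
  by apply: eq_Rintegral => t _; rewrite exprMn -mulr_natl; ring.
rewrite coef_poly coefZ (coef_1DXsqr R k.+1).2 /=.
(* The binomial is (k+1)(2k+1), and the coefficient of s^2 in (1 + s^2)^(k+1) is k+1; the common
   factor k+1 cancels at the end. *)
have -> : 'C(m, 2) = (k.+1 * k.*2.+1)%N.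
  by rewrite bin2 -[m.-1]/(k.*2.+1) /m -[in X in (X * _)%N]mul2n -mulnA mul2n doubleK.
have m2 : (m - 2)%N = k.*2 by rewrite /m doubleS subn2.
rewrite natrM /c m2.
by rewrite -mulrA mulrC => /mulIf; apply; rewrite pnatr_eq0.
Qed.

Let sum_ev2 b t : D t -> \sum_i ev b (e i) t ^+ 2 = dotcv b b.
Proof.
move=> Dt; rewrite -(orthogonal_dotcv R d _ b Dt) dotcvE.
by apply: eq_bigr => i _; rewrite /ev dotcv_delta expr2.
Qed.

(** The sum of [mixed_moment] over i <> i0, with |M b|^2 = |b|^2, reads (2k+1)(|b|^2 mu_k -
    mu_(k+1)) = (d - 1) mu_(k+1). *)
Let mu_rec b k : (k.*2 + d)%:R * mu b k.+1 = (k.*2.+1)%:R * dotcv b b * mu b k.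
Proof.
have dE : (\sum_(i | i != i0) mu b k.+1) = (d%:R - 1) * mu b k.+1.
  rewrite sumr_const cardC1 card_ord -[LHS]mulr_natl; congr (_ * _).
  by rewrite -subn1 natrB// (leq_ltn_trans _ (ltn_ord i0)).
have : \sum_(i | i != i0) ((k.*2.+1)%:R *
    \int[PO]_t (ev b (e i0) t ^+ k.*2 * ev b (e i) t ^+ 2 * \1_D t)) =
    (d%:R - 1) * mu b k.+1.
  by rewrite -dE; apply: eq_bigr => i ii0; exact: mixed_moment.
rewrite -mulr_sumr -Rintegral_sum//.
have -> : \int[PO]_t (\sum_(i | i != i0)
    ev b (e i0) t ^+ k.*2 * ev b (e i) t ^+ 2 * \1_D t) =
    dotcv b b * mu b k - mu b k.+1.
  rewrite /mu /mom -RintegralZl//; last first.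
    have := pow_integrable b (e i0) (e i0) k.*2 0.
    by congr (_.-integrable _ _); apply/funext => t /=; rewrite expr0 mulr1.
  rewrite -RintegralB//; last 2 first.
  - apply: integrable_scale => //.
    have := pow_integrable b (e i0) (e i0) k.*2 0.
    by congr (_.-integrable _ _); apply/funext => t /=; rewrite expr0 mulr1.
  - have := pow_integrable b (e i0) (e i0) k.+1.*2 0.
    by congr (_.-integrable _ _); apply/funext => t /=; rewrite expr0 mulr1.
  under [RHS]eq_Rintegral do rewrite mulrA -mulrBl.
  under eq_Rintegral do rewrite -mulr_suml -mulr_sumr.
  apply: eq_onD => t Dt; rewrite -(sum_ev2 b t Dt) [in RHS](bigD1 i0)//=.
  by rewrite doubleS !exprS; ring.
rewrite natrD -natr1 => H.
apply/eqP; rewrite -subr_eq0; apply/eqP.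
set x := (k.*2)%:R in H *; set y := mu b k.+1 in H *.
have -> : (x + d%:R) * y - (x + 1) * dotcv b b * mu b k =
  (d%:R - 1) * y - (x + 1) * (dotcv b b * mu b k - y) by ring.
by rewrite H subrr.
Qed.

Let mu0 b : mu b 0 = 1.
Proof.
by rewrite /mu /mom; under eq_Rintegral do rewrite expr0 mul1r; exact: intD.
Qed.

(** Passing from k to k+1, the factorial contributes (2k+1)(2k+2) and [mu_rec] contributes
    (2k+1)|b|^2/(2k+d). The factor 2k+1 cancels, which leaves the recursion of [sphere_coef]. *)
Let mu_coef b k : (-1) ^+ k / k.*2`!%:R * mu b k = sphere_coef R d k * dotcv b b ^+ k.
Proof.
have d0 : (0 < d)%N by rewrite (leq_ltn_trans _ (ltn_ord i0)).
elim: k => [|k IH].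
  by rewrite mu0 /sphere_coef big_ord0 !expr0 fact0 invr1.
have kd0 : (2 * k + d)%N%:R != 0 :> R by rewrite pnatr_eq0 -lt0n addn_gt0 d0 orbT.
have k0 : (2 * k.+1)%N%:R != 0 :> R by rewrite pnatr_eq0.
apply: (mulfI (mulf_neq0 k0 kd0)).
transitivity (- (dotcv b b * ((-1) ^+ k / k.*2`!%:R * mu b k))).
  have F : k.+1.*2`!%:R = (2 * k.+1)%N%:R * ((k.*2.+1)%:R * k.*2`!%:R) :> R.
    by rewrite doubleS !factS !natrM -doubleS -mul2n natrM.
  rewrite F exprS mulN1r !mulNr mulrN; congr (- _).
  transitivity ((-1) ^+ k / k.*2`!%:R / (k.*2.+1)%:R * ((k.*2 + d)%:R * mu b k.+1)).
    by rewrite -mul2n; field; rewrite -natrM !nat1r !pnatr_eq0 -!lt0n fact_gt0.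
  by rewrite mu_rec; field; rewrite nat1r !pnatr_eq0 -!lt0n fact_gt0.
by rewrite IH (sphere_coefS R d k d0) natrM exprS; ring.
Qed.

(** As k! <= (2k)!, the partial sums are dominated by those of exp(C^2). This constant is the
    majorant for integrating the cosine series term by term. *)
Let series_bound (x C : R) n : `|x| <= C ->
  `|series (cos_coeff' x) n| <= expR (C ^+ 2).
Proof.
move=> xC; have C0 : 0 <= C by exact: le_trans (normr_ge0 x) xC.
have ge0 k : 0 <= exp_coeff (C ^+ 2) k by rewrite /exp_coeff /= divr_ge0 ?exprn_ge0 ?sqr_ge0.
apply: (@le_trans _ _ (series (exp_coeff (C ^+ 2)) n)).
  rewrite /series /=; apply: (le_trans (ler_norm_sum _ _ _)); apply: ler_sum => k _.
  rewrite /cos_coeff' /exp_coeff /= !normrM normfV normr_nat -exprnP normrX normrN1.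
  rewrite expr1n mul1r normrX -mul2n exprM.
  apply: ler_pM; rewrite ?exprn_ge0 ?invr_ge0//.
    by rewrite lerXn2r ?nnegrE ?sqr_ge0// lerXn2r.
  rewrite lef_pV2 ?posrE ?ltr0n ?fact_gt0// ler_nat.
  by rewrite leq_fact// mul2n -addnn leq_addr.
rewrite /expR; apply: nondecreasing_cvgn_le; last exact: is_cvg_series_exp_coeff.
by apply: nondecreasing_series => k _ _; exact: ge0.
Qed.

Let measurable_series (b u : 'cV[R]_d) n :
  measurable_fun setT (fun t => series (cos_coeff' (ev b u t)) n).
Proof.
rewrite /series /=; apply: measurable_sum_cond => k _; rewrite /cos_coeff'.
apply: measurable_funM => //; apply: measurable_funM => //.
by apply: measurable_funX; exact: mev.
Qed.

Let measurable_cos_ev b u : measurable_fun setT (fun t => cos (ev b u t)).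
Proof.
apply: (measurableT_comp _ (mev b u)).
by apply: continuous_measurable_fun; exact: continuous_cos.
Qed.

Let cos_le1' (x : R) : `|cos x| <= 1.
Proof. by rewrite ler_norml cos_geN1 cos_le1. Qed.

(** Dominated convergence exchanges series and integral. The k-th term integrates exactly to the
    k-th term of [sphere_fun], by [mom_radial] and [mu_coef]. *)
Let cos_onD b u : \int[PO]_t (cos (ev b u t) * \1_D t) =
  sphere_fun R d (dotcv b b * dotcv u u).
Proof.
pose h (n : nat) (t : TO) : \bar R := (series (cos_coeff' (ev b u t)) n * \1_D t)%:E.
have mh n : measurable_fun setT (h n).
  apply/measurable_EFinP; apply: measurable_funM; first exact: measurable_series.
  exact: measurable_indic.
have mcos : measurable_fun setT (fun t => cos (ev b u t) * \1_D t).
  by apply: measurable_funM => //; exact: measurable_indic.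
have icos : PO.-integrable setT (EFin \o (fun t => cos (ev b u t) * \1_D t)).
  exact: (D_integrable (fun t => cos (ev b u t)) 1).
have [||||_ _ H] := @dominated_convergence _ _ _ PO setT measurableT h
  (EFin \o (fun t => cos (ev b u t) * \1_D t))
  (fun t => (expR (bnd b u ^+ 2))%:E) mh _ _ _ _.
- exact/measurable_EFinP.
- apply: aeW => t _; apply/fine_cvgP; split; first exact: nearW.
  rewrite /h /comp/=; apply: cvgM; last exact: cvg_cst.
  exact: cvg_cos_coeff'.
- exact: finite_measure_integrable_cst.
- apply: aeW => t n _; rewrite /h lee_fin indicE.
  have [/set_mem tD|_] := boolP (t \in D); last by rewrite mulr0 normr0 expR_ge0.
  by rewrite mulr1 series_bound// ev_bound.
have {}H : (\int[PO]_t (series (cos_coeff' (ev b u t)) n * \1_D t)) @[n --> \oo] -->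
    \int[PO]_t (cos (ev b u t) * \1_D t).
  have Hfin : (\int[PO]_t (cos (ev b u t) * \1_D t)%:E)%E \is a fin_num.
    exact: (integrable_fin_num measurableT icos).
  by apply: fine_cvg; rewrite fineK.
rewrite -[LHS](cvg_lim (@Rhausdorff R) H) /sphere_fun.
apply: (congr1 (fun v : R^nat => limn v)); apply/funext => n; rewrite /pseries /series /=.
have powi k : PO.-integrable setT (EFin \o (fun t => ev b u t ^+ k * \1_D t)).
  have := pow_integrable b u u k 0.
  by congr (_.-integrable _ _); apply/funext => t /=; rewrite expr0 mulr1.
under eq_Rintegral do rewrite mulr_suml.
have termE t k : cos_coeff' (ev b u t) k * \1_D t =
    (-1) ^+ k / k.*2`!%:R * (ev b u t ^+ k.*2 * \1_D t).
  by rewrite /cos_coeff' -exprnP; ring.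
rewrite Rintegral_sum//; last first.
  move=> k _; under eq_fun do rewrite termE.
  exact: integrable_scale.
apply: eq_bigr => k _; under eq_Rintegral do rewrite termE.
rewrite RintegralZl// -/(mom b k.*2 u) mom_radial mulrCA mu_coef exprMn; ring.
Qed.

Lemma haar_cos_dotcv (b u : 'cV[R]_d) :
  \int[PO]_t cos (dotcv ((M t : 'M[R]_d) *m b) u) =
  sphere_fun R d (dotcv b b * dotcv u u).
Proof.
rewrite -cos_onD -/(ev b u).
have mC : measurable (~` D) by exact: measurableC.
have PC : \int[PO]_t \1_(~` D) t = 0.
  transitivity (fine (PO (~` D))).
    by rewrite /Rintegral integral_indic// setIT.
  by rewrite probability_setC// PD subee.
have iC : PO.-integrable setT (EFin \o (fun t => cos (ev b u t) * \1_(~` D) t)).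
  apply: (@integrable_bounded_mul _ _ R PO setT (fun t => cos (ev b u t)) _ 1) => //.
  exact: integrable_indic.
have iD : PO.-integrable setT (EFin \o (fun t => cos (ev b u t) * \1_D t)).
  exact: (D_integrable (fun t => cos (ev b u t)) 1).
transitivity (\int[PO]_t (cos (ev b u t) * \1_D t + cos (ev b u t) * \1_(~` D) t)).
  apply: eq_Rintegral => t _; rewrite -mulrDr !indicE in_setC.
  by case: (t \in D); rewrite /= ?addr0 ?add0r mulr1.
rewrite RintegralD//; rewrite [X in _ + X](_ : _ = 0) ?addr0//.
apply/eqP; rewrite -normr_le0 -PC.
apply: (le_trans (le_normr_Rintegral _ iC)) => //.
apply: le_Rintegral => //.
- exact: integrable_norm.
- exact: integrable_indic.
- by move=> t _; rewrite normrM indicE normr_nat ler_piMl.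
Qed.

End haar.

(** * Variances *)

Lemma sum_delta (R : pzSemiRingType) (I : finType) (j : I) (f : I -> R) :
  \sum_i (i == j)%:R * f i = f j.
Proof.
rewrite (bigD1 j)//= eqxx mul1r big1 ?addr0// => i /negbTE ->.
by rewrite mul0r.
Qed.

Lemma Rintegral_cst_prob (d : measure_display) (T : measurableType d)
    (R : realType) (P : probability T R) (r : R) : \int[P]_t r = r.
Proof.
transitivity (r * fine (P setT)); first exact: Rintegral_cst.
by rewrite probability_setT mulr1.
Qed.

Lemma variance_bounded (d : measure_display) (T : measurableType d)
    (R : realType) (P : probability T R) (X : T -> R) (C : R) :
  measurable_fun setT X -> (forall t, `|X t| <= C) ->
  'V_P[X]%E = (\int[P]_t (X t ^+ 2) - (\int[P]_t X t) ^+ 2)%:E.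
Proof.
move=> mX XC; pose m := \int[P]_t X t.
have i1 : P.-integrable setT (EFin \o cst (1 : R)).
  exact: finite_measure_integrable_cst.
have bi (f : T -> R) K : measurable_fun setT f -> (forall t, `|f t| <= K) ->
    P.-integrable setT (EFin \o f).
  move=> mf fK.
  have := @integrable_bounded_mul _ _ R P setT f (cst 1) K measurableT mf
    (fun t _ => fK t) i1.
  by congr (_.-integrable _ _); apply/funext => t /=; rewrite mulr1.
have C0 (t : T) : 0 <= C by exact: le_trans (normr_ge0 (X t)) (XC t).
have iX := bi X C mX XC.
have iX2 : P.-integrable setT (EFin \o (fun t => X t ^+ 2)).
  apply: (bi _ (C ^+ 2)); first exact: measurable_funX.
  by move=> t; rewrite normrX lerXn2r ?nnegrE// (C0 t).
have iV : P.-integrable setT (EFin \o (fun t => (X t - m) ^+ 2)).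
  apply: (bi _ ((C + `|m|) ^+ 2)).
    by apply: measurable_funX; apply: measurable_funB.
  move=> t; rewrite normrX lerXn2r ?nnegrE ?addr_ge0 ?(C0 t)//.
  by apply: (le_trans (ler_normB _ _)); rewrite lerD2r.
transitivity (\int[P]_t (X t - m) ^+ 2)%:E.
  rewrite /variance unlock unlock /Rintegral fineK; last first.
    exact: (integrable_fin_num measurableT iV).
  by apply: eq_integral => t _; rewrite /= expr2.
congr EFin.
transitivity (\int[P]_t (X t ^+ 2 - (2 * m * X t - m ^+ 2))).
  by apply: eq_Rintegral => t _; ring.
have i2 : P.-integrable setT (EFin \o (fun t => 2 * m * X t)).
  exact: integrable_scale.
have i3 : P.-integrable setT (EFin \o (fun t : T => m ^+ 2)).
  exact: finite_measure_integrable_cst.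
rewrite RintegralB//; last by have := integrableB measurableT i2 i3.
rewrite RintegralB// RintegralZl// Rintegral_cst_prob -/m.
by ring.
Qed.

(** The last hypothesis holds for both laws, with different F. The choices a = 0, e_j and e_j + e_k,
    e_j - e_k give F 0 = 1, the means, and through the product formula for cosines all the second
    moments. *)
Lemma variance_cos_mean (d : measure_display) (T : measurableType d)
    (R : realType) (P : probability T R) (p : nat) (Y : 'I_p -> T -> R)
    (F : R -> R) (s : R) : (0 < p)%N ->
  (forall j, measurable_fun setT (Y j)) ->
  (forall a : 'I_p -> R,
    \int[P]_t cos (\sum_j a j * Y j t) = F (\sum_j a j ^+ 2 * s)) ->
  'V_P[(fun t => p%:R^-1 * \sum_j cos (Y j t))%R]%E =
  (((1 + F (4 * s)) / 2 + (p%:R - 1) * F (2 * s)) / p%:R - F s ^+ 2)%:E.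
Proof.
move=> p0 mY hF.
have pR : 0 < p%:R :> R by rewrite ltr0n.
have cosC (x : R) : `|cos x| <= 1 by rewrite ler_norml cos_geN1 cos_le1.
have mcos : measurable_fun setT (@cos R).
  by apply: continuous_measurable_fun; exact: continuous_cos.
have i1 : P.-integrable setT (EFin \o cst (1 : R)).
  exact: finite_measure_integrable_cst.
have icos (f : T -> R) : measurable_fun setT f ->
    P.-integrable setT (EFin \o (fun t => cos (f t))).
  move=> mf.
  have := @integrable_bounded_mul _ _ R P setT (fun t => cos (f t)) (cst 1) 1
    measurableT (measurableT_comp mcos mf) (fun t _ => cosC (f t)) i1.
  by congr (_.-integrable _ _); apply/funext => t /=; rewrite mulr1.
have F0 : F 0 = 1.
  have := hF (fun=> 0); rewrite big1; last by move=> j _; rewrite expr0n mul0r.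
  move=> <-; transitivity (\int[P]_t (1 : R)).
    apply: eq_Rintegral => t _; rewrite big1 ?cos0// => j _; exact: mul0r.
  by rewrite Rintegral_cst_prob.
have E1 j : \int[P]_t cos (Y j t) = F s.
  have := hF (fun i => (i == j)%:R).
  under eq_Rintegral do rewrite sum_delta.
  move=> ->; congr F; rewrite -[RHS](sum_delta _ _ j (fun=> s)).
  by apply: eq_bigr => i _; case: (i == j); rewrite ?expr1n ?expr0n.
(* Used for e = 1 and e = -1: the squared norm of e_j + e e_k is 4 or 0 when j = k, and 2
   otherwise. *)
have E2 j k (e : R) : e ^+ 2 = 1 -> \int[P]_t cos (Y j t + e * Y k t) =
    F ((2 + 2 * e * (j == k)%:R) * s).
  move=> e2; have := hF (fun i => (i == j)%:R + e * (i == k)%:R).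
  have -> : (fun t => cos (\sum_i ((i == j)%:R + e * (i == k)%:R) * Y i t)) =
      (fun t => cos (Y j t + e * Y k t)).
    apply/funext => t; congr cos.
    under eq_bigr do rewrite mulrDl -mulrA.
    by rewrite big_split/= -mulr_sumr !sum_delta.
  move=> ->; congr F; rewrite -mulr_suml; congr (_ * _).
  transitivity (\sum_i ((i == j)%:R * 1 + (i == k)%:R * 1 +
      (i == j)%:R * (2 * e * (i == k)%:R)) : R).
    apply: eq_bigr => i _; case: (i == j); case: (i == k);
      rewrite /= ?mulr0 ?mulr1 ?addr0 ?add0r ?expr0n ?expr1n ?e2//=; ring: e2.
  rewrite !big_split/= !sum_delta.
  ring.
have prodE (x y : R) : cos x * cos y = 2^-1 * (cos (x + 1 * y) + cos (x + -1 * y)).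
  by rewrite mul1r mulN1r cosD cosB; field.
have E3 j k : \int[P]_t (cos (Y j t) * cos (Y k t)) =
    if j == k then (1 + F (4 * s)) / 2 else F (2 * s).
  under eq_Rintegral do rewrite prodE.
  have m1 e : measurable_fun setT (fun t => Y j t + e * Y k t).
    by apply: measurable_funD => //; apply: measurable_funM.
  have ia : P.-integrable setT (EFin \o (fun t =>
      cos (Y j t + 1 * Y k t) + cos (Y j t + -1 * Y k t))).
    by have := integrableD measurableT (icos _ (m1 1)) (icos _ (m1 (-1))).
  rewrite RintegralZl// RintegralD//; [|exact: icos..].
  rewrite !E2 ?sqrrN ?expr1n//; case: (j == k) => /=.
    rewrite (_ : (2 + 2 * 1 * 1) * s = 4 * s); last by ring.
    rewrite (_ : (2 + 2 * -1 * 1) * s = 0); last by ring.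
    by rewrite F0; ring.
  by rewrite !mulr0 addr0; field.
have mX : measurable_fun setT (fun t => p%:R^-1 * \sum_j cos (Y j t)).
  apply: measurable_funM => //; apply: measurable_sum_cond => j _.
  exact: (measurableT_comp mcos (mY j)).
rewrite (variance_bounded _ _ _ _ _ 1 mX); last first.
  move=> t; rewrite normrM ger0_norm ?invr_ge0//.
  rewrite mulrC ler_pdivrMr// mul1r; apply: (le_trans (ler_norm_sum _ _ _)).
  rewrite -[leRHS]mulr_natr mul1r -[in leRHS](card_ord p) -sumr_const.
  by apply: ler_sum => j _; exact: cosC.
congr EFin; congr (_ - _); last first.
  rewrite RintegralZl//; last by apply: integrable_sum_EFin => // j _; exact: icos.
  rewrite Rintegral_sum//; last by move=> j _; exact: icos.
  under eq_bigr do rewrite E1.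
  by rewrite sumr_const card_ord -[F s *+ p]mulr_natl mulrA mulVf ?gt_eqF// mul1r.
have ijk j k : P.-integrable setT (EFin \o (fun t => cos (Y j t) * cos (Y k t))).
  apply: (@integrable_bounded_mul _ _ R P setT (fun t => cos (Y j t)) _ 1) => //.
    exact: (measurableT_comp mcos (mY j)).
  exact: icos.
transitivity (\int[P]_t (p%:R^-1 ^+ 2 * \sum_j \sum_k cos (Y j t) * cos (Y k t))).
  apply: eq_Rintegral => t _; rewrite exprMn; congr (_ * _).
  by rewrite expr2 mulr_suml; apply: eq_bigr => j _; rewrite mulr_sumr.
rewrite RintegralZl//; last first.
  by apply: integrable_sum_EFin => // j _; exact: integrable_sum_EFin.
rewrite Rintegral_sum//; last by move=> j _; exact: integrable_sum_EFin.
have row j : \int[P]_t (\sum_k cos (Y j t) * cos (Y k t)) =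
    (1 + F (4 * s)) / 2 + (p%:R - 1) * F (2 * s).
  rewrite Rintegral_sum// (bigD1 j)//= E3 eqxx; congr (_ + _).
  rewrite (eq_bigr (fun=> F (2 * s))); last first.
    by move=> k kj; rewrite E3 eq_sym (negbTE kj).
  rewrite sumr_const cardC1 card_ord -[LHS]mulr_natl; congr (_ * _).
  by rewrite -subn1 natrB.
under eq_bigr do rewrite row.
rewrite sumr_const card_ord -[_ *+ p]mulr_natl; field.
by rewrite gt_eqF.
Qed.

(** The two alternatives for s are s <= alpha_d^2 and s <= beta_d^2. The bound F(s) <= 1 is
    probabilistic: F(s) is the mean of a cosine. *)
Lemma sphere_fun_variance_le (R : realType) (p d : nat) (s : R) :
  (0 < p)%N -> (2 <= d)%N -> 0 <= s ->
  (s <= d%:R / 2 * Num.sqrt (d%:R / 2)) || (s <= ((d%:R / 2) ^+ 2 - 1) / 4) ->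
  sphere_fun R d s <= 1 ->
  ((1 + sphere_fun R d (4 * s)) / 2 + (p%:R - 1) * sphere_fun R d (2 * s)) / p%:R
    - sphere_fun R d s ^+ 2 <=
  ((1 + expR (- (4 * s / 2))) / 2 + (p%:R - 1) * expR (- (2 * s / 2))) / p%:R
    - expR (- (s / 2)) ^+ 2.
Proof.
move=> p0 d2 s0 hs F1; set n := d%:R / 2 in hs *.
have d0 : (0 < d)%N by exact: ltn_trans d2.
have dR : 2 <= d%:R :> R by rewrite ler_nat.
have n1 : 1 <= n by rewrite /n; lra.
have sqn : Num.sqrt n <= n.
  by rewrite -[leRHS]ger0_norm ?(le_trans ler01)// -sqrtr_sqr ler_wsqrtr// expr2 ler_peMl ?(le_trans ler01).
have sq0 := sqrtr_ge0 n.
(* In the first case 4s <= 4 n sqrt n, in the second 4s <= n^2 - 1: the ranges of [sphere_fun_gt0]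
   and [sphere_fun_ge_exp]. *)
have pos t : 0 <= t <= 4 * s -> 0 < sphere_fun R d t.
  move=> /andP[t0 t4]; case/orP: hs => hs.
    by apply: sphere_fun_gt0; rewrite // t0/= -/n; lra.
  apply: lt_le_trans (expR_gt0 _) (sphere_fun_ge_exp R d d0 t _).
  by rewrite t0/= -/n; lra.
have sn2 : s <= n ^+ 2.
  case/orP: hs => hs; last by have := sqr_ge0 n; lra.
  by apply: (le_trans hs); rewrite expr2 ler_wpM2l// (le_trans ler01).
have FE : expR (- (s / 2)) <= sphere_fun R d s.
  apply: le_trans (sphere_fun_ge_exp R d d0 s _); last by rewrite s0.
  (* Here d >= 2 enters, through s/d <= s/2. *)
  rewrite ler_expR lerN2 ler_wpM2l// lef_pV2// posrE; lra.
have F2 : sphere_fun R d (2 * s) <= sphere_fun R d s ^+ 2.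
  apply: sphere_fun_double => // t /andP[t0 t2]; apply: pos.
  by rewrite t0/=; lra.
have F2pos : 0 < sphere_fun R d (2 * s) by apply: pos; apply/andP; split; lra.
have F4 : sphere_fun R d (4 * s) <= sphere_fun R d s ^+ 2 ^+ 2.
  rewrite (_ : 4 * s = 2 * (2 * s)); last by ring.
  apply: (@le_trans _ _ (sphere_fun R d (2 * s) ^+ 2)).
    apply: sphere_fun_double => //; first by lra.
    by move=> t /andP[t0 t4]; apply: pos; rewrite t0/=; lra.
  by rewrite lerXn2r ?nnegrE ?sqr_ge0// ltW.
set E := expR (- (s / 2)) in FE *.
have E0 : 0 < E by exact: expR_gt0.
have -> : expR (- (2 * s / 2)) = E ^+ 2.
  by rewrite /E -expRM_natl; congr expR; field.
have -> : expR (- (4 * s / 2)) = E ^+ 2 ^+ 2.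
  by rewrite /E -!expRM_natl; congr expR; field.
have FF0 : 0 < sphere_fun R d s by exact: lt_le_trans FE.
have TS : E ^+ 2 <= sphere_fun R d s ^+ 2 by rewrite lerXn2r ?nnegrE// ltW.
have S1 : sphere_fun R d s ^+ 2 <= 1 by rewrite expr_le1// ltW.
move: F2 F4 TS S1.
set S := sphere_fun R d s ^+ 2; set T := E ^+ 2 => F2 F4 TS S1.
have pR : 1 <= p%:R :> R by rewrite ler1n.
have pR0 : 0 < p%:R :> R by rewrite ltr0n.
(* Both sides take this form, with a = S and a = T, and (1 - a)^2 is nonincreasing for a <= 1. *)
have sqE (a : R) : ((1 + a ^+ 2) / 2 + (p%:R - 1) * a) / p%:R - a =
    (1 - a) ^+ 2 / (2 * p%:R) by field; rewrite gt_eqF.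
apply: (@le_trans _ _ (((1 + S ^+ 2) / 2 + (p%:R - 1) * S) / p%:R - S)).
  rewrite lerD2r ler_pM2r ?invr_gt0// lerD//; first by lra.
  by rewrite ler_wpM2l// subr_ge0.
rewrite !sqE ler_pM2r ?invr_gt0 ?mulr_gt0// lerXn2r ?nnegrE ?subr_ge0//; first lra.
by rewrite lerD2l lerN2.
Qed.

Lemma alpha_sqr (R : realType) (d : nat) :
  alpha R d ^+ 2 = d%:R / 2 * Num.sqrt (d%:R / 2).
Proof.
have n0 : 0 <= d%:R / 2 :> R by rewrite divr_ge0.
rewrite /alpha -powR_mulrn ?powR_ge0// -powRrM.
rewrite (_ : 3 / 4 * 2 = 1 + 2^-1 :> R); last by field.
have h : 1 + 2^-1 != 0 :> R by lra.
rewrite powRD ?(negbTE h)//.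
by rewrite powRr1// powR12_sqrt.
Qed.

Lemma dotcv_suml (R : realType) (d : nat) (I : finType) (a : I -> R)
    (v : I -> 'cV[R]_d) (w : 'cV[R]_d) :
  dotcv (\sum_i a i *: v i) w = \sum_i a i * dotcv (v i) w.
Proof.
rewrite /dotcv linear_sum /= mulmx_suml summxE.
by apply: eq_bigr => i _; rewrite linearZ /= -scalemxAl mxE.
Qed.

Theorem proposition6 (R : realType) (p d : nat) (h2p : (2 <= p)%N)
  (hpd : (p <= d)%N)
  (dO : measure_display) (TO : measurableType dO) (PO : probability TO R)
  (M : {RV PO >-> borelType 'M[R]_d}) (hM : is_haar_orthogonal (distribution PO M))
  (c : 'I_p -> 'I_d) (hc : injective c)
  (dG : measure_display) (TG : measurableType dG) (PG : probability TG R)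
  (G : 'I_d * 'I_p -> {RV PG >-> R}) (hG : iid_standard_normal G)
  (x y : 'cV[R]_d)
  (hz : enorm (x - y) \in `[0, Num.max (alpha R d) (beta R d)]) :
  ('V_PO[kernel_ORF M c x y] <= 'V_PG[kernel_RFF G x y])%E.
Proof.
have p0 : (0 < p)%N by exact: ltn_trans h2p.
have d2 : (2 <= d)%N by exact: leq_trans hpd.
pose u := x - y; pose s := dotcv u u.
have s0 : 0 <= s by exact: dotcv_ge0.
pose Y (j : 'I_p) (t : TO) := dotcv (col (c j) (M t : 'M[R]_d)) u.
have YE j t : Y j t = dotcv ((M t : 'M[R]_d) *m delta_mx (c j) 0) u.
  by rewrite /Y colE.
have mY j : measurable_fun setT (Y j).
  rewrite (_ : Y j = fun t => dotcv ((M t : 'M[R]_d) *m delta_mx (c j) 0) u); last first.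
    by apply/funext => t; exact: YE.
  exact: (measurableT_comp (measurable_dotcv_mulmx R d _ u) (measurable_funP M)).
have cosY (a : 'I_p -> R) : \int[PO]_t cos (\sum_j a j * Y j t) =
    sphere_fun R d (\sum_j a j ^+ 2 * s).
  pose b : 'cV[R]_d := \sum_j a j *: delta_mx (c j) 0.
  (* Injectivity of c makes the selected basis vectors orthonormal. *)
  have bb : dotcv b b = \sum_j a j ^+ 2.
    rewrite {1}/b dotcv_suml; apply: eq_bigr => j _.
    rewrite dotcvC dotcv_delta /b summxE (bigD1 j)//= !mxE !eqxx mulr1 big1 ?addr0//.
    move=> k kj; rewrite !mxE (inj_eq hc) eq_sym (negbTE kj); exact: mulr0.
  rewrite -mulr_suml -bb -(haar_cos_dotcv R d dO TO PO M hM (c (Ordinal p0))).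
  apply: eq_Rintegral => t _; rewrite dotcv_mulmx dotcv_suml; congr cos.
  by apply: eq_bigr => j _; rewrite YE dotcv_mulmx.
pose Z (j : 'I_p) (t : TG) := dotcv (\col_i G (i, j) t) u.
have ZE j t : Z j t = \sum_i G (i, j) t * u i 0.
  by rewrite /Z dotcvE; apply: eq_bigr => i _; rewrite mxE.
have mZ j : measurable_fun setT (Z j).
  rewrite (_ : Z j = fun t => \sum_i G (i, j) t * u i 0); last first.
    by apply/funext => t; exact: ZE.
  by apply: measurable_sum_cond => i _; apply: measurable_funM.
have cosZ (a : 'I_p -> R) : \int[PG]_t cos (\sum_j a j * Z j t) =
    expR (- ((\sum_j a j ^+ 2 * s) / 2)).
  (* The sum of the a_j Z_j is one linear combination of all the entries of G, with coefficients u_i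
     a_j. *)
  have := iid_normal_cos_sum R dG TG PG _ G hG (fun ij => u ij.1 0 * a ij.2).
  have -> : \sum_ij (u ij.1 0 * a ij.2) ^+ 2 = \sum_j a j ^+ 2 * s.
    transitivity (\sum_i \sum_j (u i 0 * a j) ^+ 2); first by rewrite pair_bigA.
    rewrite exchange_big/=.
    apply: eq_bigr => j _; rewrite /s dotcvE mulr_sumr.
    by apply: eq_bigr => i _; ring.
  move=> <-; apply: eq_Rintegral => t _; congr cos; apply: esym.
  transitivity (\sum_i \sum_j u i 0 * a j * G (i, j) t).
    by rewrite pair_bigA; apply: eq_bigr => -[i j] _.
  rewrite exchange_big/=.
  apply: eq_bigr => j _; rewrite ZE mulr_sumr.
  by apply: eq_bigr => i _; ring.
rewrite (_ : kernel_ORF M c x y = fun t => p%:R^-1 * \sum_j cos (Y j t)); last first.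
  by apply/funext => t; rewrite /kernel_ORF approx_kernelE.
rewrite (_ : kernel_RFF G x y = fun t => p%:R^-1 * \sum_j cos (Z j t)); last first.
  by apply/funext => t; rewrite /kernel_RFF approx_kernelE.
rewrite (variance_cos_mean _ _ _ _ _ _ _ _ p0 mY cosY).
rewrite (variance_cos_mean _ _ _ _ _ _ (fun r => expR (- (r / 2))) _ p0 mZ cosZ).
rewrite lee_fin; apply: sphere_fun_variance_le => //.
  have : Num.sqrt s <= alpha R d \/ Num.sqrt s <= beta R d.
    by move: hz; rewrite in_itv/= le_max => /andP[_ /orP].
  have sq (e : R) : Num.sqrt s <= e -> s <= e ^+ 2.
    move=> se; rewrite -[leLHS](sqr_sqrtr s0) lerXn2r ?nnegrE ?sqrtr_ge0//.
    exact: le_trans (sqrtr_ge0 s) se.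
  case=> /sq hs; apply/orP; [left|right]; first by rewrite -alpha_sqr.
  (* The square root squares back because d >= 2 makes its argument nonnegative. *)
  apply: (le_trans hs); rewrite /beta exprMn sqr_sqrtr.
    by rewrite le_eqVlt; apply/orP; left; apply/eqP; field.
  have : 2 <= d%:R :> R by rewrite ler_nat.
  by move=> dR; nra.
(* F(s) <= 1: for a = e_j0, F(s) is the mean of cos (Y j0). *)
pose j0 := Ordinal p0.
have := cosY (fun i => (i == j0)%:R).
under eq_Rintegral do rewrite sum_delta.
have -> : \sum_j (j == j0)%:R ^+ 2 * s = s.
  rewrite -[RHS](sum_delta _ _ j0 (fun=> s)).
  by apply: eq_bigr => i _; case: (i == j0); rewrite ?expr1n ?expr0n.
move=> <-; rewrite -[leRHS](Rintegral_cst_prob _ _ _ PO 1).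
have cosC (r : R) : `|cos r| <= 1 by rewrite ler_norml cos_geN1 cos_le1.
apply: le_Rintegral => //.
- have i1 : PO.-integrable setT (EFin \o cst (1 : R)).
    exact: finite_measure_integrable_cst.
  have mcos : measurable_fun setT (fun t => cos (Y j0 t)).
    apply: (measurableT_comp _ (mY j0)).
    by apply: continuous_measurable_fun; exact: continuous_cos.
  have := @integrable_bounded_mul _ _ R PO setT (fun t => cos (Y j0 t)) (cst 1) 1
    measurableT mcos (fun t _ => cosC (Y j0 t)) i1.
  by congr (_.-integrable _ _); apply/funext => t /=; rewrite mulr1.
- exact: finite_measure_integrable_cst.
Qed.
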